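(* Let $n\ge3$ and work in the formal, real analytic or holomorphic category. Let $f\in\mathcal F(\mathbb K^n)$ be a quasihomogeneous polynomial of degree $\mathrm N$ with respect to weights $w_1,\dots,w_n$, with $f(0)=0$ and of finite codimension. Let $E$ be the space of $(n-1)$-forms $h\sigma$ where $h$ is a quasihomogeneous polynomial of degree $\mathrm N-\sum_i w_i$, and let $F$ be the quotient of the vector space $\{df\wedge d\gamma:\gamma\in\Omega^{n-3}(\mathbb K^n)\}$ by the subspace $\{df\wedge d(f\beta):\beta\in\Omega^{n-3}(\mathbb K^n)\}$. Then $$H^{n-1}_{f,n-2}(\mathbb K^n)=E\oplus F,$$ where $E$ and $F$ are identified with their images in cohomology under the natural maps.
   Context: $\mathbb K=\mathbb R$ or $\mathbb C$. $\mathcal F(\mathbb K^n)$ and $\Omega^k(\mathbb K^n)$ denote the spaces of germs at $0$ of functions and $k$-forms in the chosen category (formal power series, and forms with such coefficients, in the formal case). $f$ is of finite codimension if $Q_f=\mathcal F(\mathbb K^n)/I_f$ is finite dimensional, $I_f$ being the ideal generated by the partial derivatives of $f$. The weights $w_1,\dots,w_n$ are positive integers, $W=\sum_iw_ix_i\frac{\partial}{\partial x_i}$, and a tensor $T$ is quasihomogeneous of degree $d$ if $\mathcal L_WT=dT$ (so $W.f=\mathrm Nf$). $\omega=dx_1\wedge\dots\wedge dx_n$ and $\sigma=i_W\omega$. For $p\in\mathbb Z$, $d_f^{(p)}:\Omega^k(\mathbb K^n)\to\Omega^{k+1}(\mathbb K^n)$ is $d_f^{(p)}\alpha=f\,d\alpha-(k-p)\,df\wedge\alpha$,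 and $H^k_{f,p}(\mathbb K^n)$ is the $k$-th cohomology space of $(\Omega^\bullet(\mathbb K^n),d_f^{(p)})$. In particular $$H^{n-1}_{f,n-2}(\mathbb K^n)=\{\alpha\in\Omega^{n-1}(\mathbb K^n): f\,d\alpha-df\wedge\alpha=0\}\,/\,\{f\,d\xi:\xi\in\Omega^{n-2}(\mathbb K^n)\}.$$ *)

(* Defs.v *)
From HB Require Import structures.
From mathcomp Require Import all_boot all_order all_algebra.
From mathcomp Require Import boolp reals complex mpoly.

Set Implicit Arguments.
Unset Strict Implicit.
Unset Printing Implicit Defensive.

Import Order.TTheory GRing.Theory Num.Theory.

Local Open Scope ring_scope.

(* Subspaces are predicates with a [submodClosed] structure; they need not be
   finite dimensional.  [subquot Z B] is Z / (Z :&: B); it is only used with B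
   contained in Z. *)
Section Subquotient.
Variables (K : fieldType) (V : lmodType K).

Definition subspace (Z : submodClosed V) : Type := {v : V | v \in Z}.

HB.instance Definition _ (Z : submodClosed V) :=
  [isSub of subspace Z for @sval V (fun v => v \in Z)].
HB.instance Definition _ (Z : submodClosed V) :=
  [Choice of subspace Z by <:].
HB.instance Definition _ (Z : submodClosed V) :=
  [SubChoice_isSubLmodule of subspace Z by <:].

Definition relative (Z B : submodClosed V) : {pred subspace Z} :=
  fun z => val z \in B.
Arguments relative : clear implicits.

Lemma relative_submod_closed (Z B : submodClosed V) :
  submod_closed (relative Z B).
Proof.
split=> [|a x y xB yB]; rewrite unfold_in /relative.
  by rewrite (raddf0 (val : subspace Z -> V)) rpred0.
by rewrite (linearP (val : subspace Z -> V)) rpredD ?rpredZ.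
Qed.

HB.instance Definition _ (Z B : submodClosed V) :=
  GRing.isSubmodClosed.Build K (subspace Z) (relative Z B)
    (relative_submod_closed Z B).

Definition subquot (Z B : submodClosed V) : Type :=
  Quotient.quot (relative Z B).

Section Instances.
Variables Z B : submodClosed V.
Local Open Scope quotient_scope.

HB.instance Definition _ := GRing.Zmodule.on (subquot Z B).

Definition proj (z : subspace Z) : subquot Z B :=
  \pi_(Quotient.quot (relative Z B)) z.

Lemma proj_eq (x y : subspace Z) :
  proj x = proj y <-> val x - val y \in B.
Proof.
rewrite -raddfB -[_ \in B]/(x - y \in relative Z B).
by rewrite Quotient.idealrBE; split=> /eqP.
Qed.

Lemma proj_surj (q : subquot Z B) : exists z, q = proj z.
Proof. by exists (repr q); rewrite /proj reprK. Qed.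

Lemma proj_zmod_morphism : zmod_morphism proj.
Proof. exact: (raddfB (\pi_(Quotient.quot (relative Z B)))). Qed.

HB.instance Definition _ :=
  GRing.isZmodMorphism.Build (subspace Z) (subquot Z B) proj
    proj_zmod_morphism.

Definition subquot_scale (a : K) (q : subquot Z B) : subquot Z B :=
  proj (a *: (repr (q : Quotient.quot (relative Z B)))).

Lemma subquot_scaleE a z : subquot_scale a (proj z) = proj (a *: z).
Proof.
apply/proj_eq; rewrite !(linearZ_LR (val : subspace Z -> V)) /=.
by rewrite -scalerBr rpredZ //; apply/proj_eq; rewrite /proj reprK.
Qed.

Fact subquot_scaleA a b q :
  subquot_scale a (subquot_scale b q) = subquot_scale (a * b) q.
Proof. by have [z ->] := proj_surj q; rewrite !subquot_scaleE scalerA. Qed.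

Fact subquot_scale1 : left_id 1 subquot_scale.
Proof. by move=> q; have [z ->] := proj_surj q; rewrite !subquot_scaleE scale1r. Qed.

Fact subquot_scaleDr : right_distributive subquot_scale +%R.
Proof.
move=> a p q; have [x ->] := proj_surj p; have [y ->] := proj_surj q.
by rewrite -raddfD !subquot_scaleE scalerDr raddfD.
Qed.

Fact subquot_scaleDl q : {morph subquot_scale^~ q : a b / a + b}.
Proof.
move=> a b; have [z ->] := proj_surj q.
by rewrite !subquot_scaleE scalerDl raddfD.
Qed.

HB.instance Definition _ :=
  GRing.Zmodule_isLmodule.Build K (subquot Z B)
    subquot_scaleA subquot_scale1 subquot_scaleDr subquot_scaleDl.

Lemma proj_scalable : scalable proj.
Proof. by move=> a z; rewrite -subquot_scaleE. Qed.

HB.instance Definition _ :=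
  GRing.isScalable.Build K (subspace Z) (subquot Z B) *:%R proj proj_scalable.

End Instances.

(* The maps Z1 -> Z2 / B2 and Z1 / B1 -> Z2 / B2 induced by an inclusion of Z1
   in Z2; the predicates include the claim that there is such an inclusion. *)
Definition natural_map (Z1 Z2 B2 : submodClosed V)
    (g : subspace Z1 -> subquot Z2 B2) : Prop :=
  forall z1 : subspace Z1,
    exists2 z2 : subspace Z2, val z2 = val z1 & g z1 = proj B2 z2.

Definition natural_quotient_map (Z1 B1 Z2 B2 : submodClosed V)
    (g : subquot Z1 B1 -> subquot Z2 B2) : Prop :=
  natural_map (fun z1 : subspace Z1 => g (proj B1 z1)).

End Subquotient.

Definition finite_dimensional (K : fieldType) (V : lmodType K) : Prop :=
  exists (d : nat) (e : 'I_d -> V),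
    forall v : V, exists a : 'I_d -> K, v = \sum_i a i *: e i.

(* Formal power series, given by their coefficients. *)
Definition series (n : nat) (K : Type) : Type := 'X_{1..n} -> K.

HB.instance Definition _ n K := gen_eqMixin (series n K).
HB.instance Definition _ n K := gen_choiceMixin (series n K).

Section SeriesAlgebra.
Variables (n : nat) (K : comNzRingType).
Implicit Types (a b c : series n K) (m : 'X_{1..n}).

Definition series_zero : series n K := fun=> 0.
Definition series_add a b : series n K := fun m => a m + b m.
Definition series_opp a : series n K := fun m => - a m.

Fact series_addA : associative series_add.
Proof. by move=> a b c; apply/funext => m; apply: addrA. Qed.
Fact series_addC : commutative series_add.
Proof. by move=> a b; apply/funext => m; apply: addrC. Qed.
Fact series_add0 : left_id series_zero series_add.
Proof. by move=> a; apply/funext => m; apply: add0r. Qed.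
Fact series_addN : left_inverse series_zero series_opp series_add.
Proof. by move=> a; apply/funext => m; apply: addNr. Qed.

HB.instance Definition _ := GRing.isZmodule.Build (series n K)
  series_addA series_addC series_add0 series_addN.

Definition poly_series (p : {mpoly K[n]}) : series n K := fun m => p@_m.

Definition series_one : series n K := poly_series 1.

Definition series_mul a b : series n K := fun m =>
  \sum_(k : 'X_{1..n < (mdeg m).+1, (mdeg m).+1} | m == (k.1 + k.2)%MM)
    a k.1 * b k.2.

Definition truncation (d : nat) a : {mpoly K[n]} :=
  \sum_(m : 'X_{1..n < d}) a m *: 'X_[m].

Lemma truncationE d a m : (mdeg m < d)%N -> (truncation d a)@_m = a m.
Proof. exact: mcoeff_mpoly. Qed.

Lemma series_mulE a b (p q : {mpoly K[n]}) m :
    (forall k : 'X_{1..n}, (mdeg k <= mdeg m)%N -> p@_k = a k) ->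
    (forall k : 'X_{1..n}, (mdeg k <= mdeg m)%N -> q@_k = b k) ->
  series_mul a b m = (p * q)@_m.
Proof.
move=> pa qb; rewrite mcoeffM; apply: eq_bigr => k _.
by rewrite pa ?qb // -ltnS bmdeg.
Qed.

Fact series_mulA : associative series_mul.
Proof.
move=> a b c; apply/funext => m; pose T := truncation (mdeg m).+1.
have TE u k : (mdeg k <= mdeg m)%N -> (T u)@_k = u k.
  by move=> km; apply: truncationE.
have ME u v k : (mdeg k <= mdeg m)%N -> (T u * T v)@_k = series_mul u v k.
  by move=> km; rewrite -(@series_mulE u v) // => l lk;
     apply: TE; apply: leq_trans km.
rewrite (@series_mulE _ _ (T a) (T b * T c)) ?mulrA; [|exact: TE|exact: ME].
by rewrite -(@series_mulE (series_mul a b) c (T a * T b) (T c)); [|exact: ME|exact: TE].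
Qed.

Fact series_mulC : commutative series_mul.
Proof.
move=> a b; apply/funext => m; pose T := truncation (mdeg m).+1.
have TE u k : (mdeg k <= mdeg m)%N -> (T u)@_k = u k.
  by move=> km; apply: truncationE.
rewrite (@series_mulE _ _ (T a) (T b)) 1?mulrC; [|exact: TE|exact: TE].
by rewrite -(@series_mulE b a (T b) (T a)); [|exact: TE|exact: TE].
Qed.

Fact series_mul1 : left_id series_one series_mul.
Proof.
move=> a; apply/funext => m.
rewrite (@series_mulE _ _ 1 (truncation (mdeg m).+1 a)) //.
  by rewrite mul1r truncationE.
by move=> k km; apply: truncationE.
Qed.

Fact series_mulDl : left_distributive series_mul +%R.
Proof.
move=> a b c; apply/funext => m; rewrite /GRing.add /= /series_add.
by rewrite -big_split; apply: eq_bigr => k _; rewrite mulrDl.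
Qed.

Fact series_one_neq0 : series_one != 0.
Proof.
apply/eqP => /(congr1 (fun a : series n K => a 0%MM)).
by rewrite /series_one /poly_series mcoeff1 eqxx; apply/eqP; rewrite oner_eq0.
Qed.

HB.instance Definition _ := GRing.Zmodule_isComNzRing.Build (series n K)
  series_mulA series_mulC series_mul1 series_mulDl series_one_neq0.

Definition series_scale (t : K) a : series n K := fun m => t * a m.

Fact series_scaleA s t a :
  series_scale s (series_scale t a) = series_scale (s * t) a.
Proof. by apply/funext => m; apply: mulrA. Qed.
Fact series_scale1 : left_id 1 series_scale.
Proof. by move=> a; apply/funext => m; apply: mul1r. Qed.
Fact series_scaleDr : right_distributive series_scale +%R.
Proof. by move=> t a b; apply/funext => m; apply: mulrDr. Qed.
Fact series_scaleDl a : {morph series_scale^~ a : s t / s + t}.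
Proof. by move=> s t; apply/funext => m; apply: mulrDl. Qed.

HB.instance Definition _ := GRing.Zmodule_isLmodule.Build K (series n K)
  series_scaleA series_scale1 series_scaleDr series_scaleDl.

Fact series_scaleAl t a b : t *: (a * b) = t *: a * b.
Proof.
apply/funext => m.
rewrite -[LHS]/(t * series_mul a b m).
rewrite -[RHS]/(series_mul (series_scale t a) b m) /series_mul mulr_sumr.
by apply: eq_bigr => k _; apply: mulrA.
Qed.

HB.instance Definition _ :=
  GRing.Lmodule_isLalgebra.Build K (series n K) series_scaleAl.
HB.instance Definition _ :=
  GRing.Lalgebra_isComAlgebra.Build K (series n K).

Definition partial (i : 'I_n) a : series n K :=
  fun m => a (m + U_(i))%MM *+ (m i).+1.

Lemma partial_linear i : linear (partial i).
Proof.
move=> t a b; apply/funext => m; rewrite -[LHS]/((t * a _ + b _) *+ _).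
by rewrite mulrnDl -mulrnAr.
Qed.

HB.instance Definition _ i := GRing.isLinear.Build K (series n K) (series n K)
  *:%R (partial i) (partial_linear i).

End SeriesAlgebra.

Inductive ground_field := RealNumbers | ComplexNumbers.

Definition scalars (R : realType) (k : ground_field) : numFieldType :=
  match k with RealNumbers => R | ComplexNumbers => R[i] end.

(* [Analytic] is the real analytic category over R and the holomorphic one
   over R[i]. *)
Inductive category := Formal | Analytic.

Section Germs.
Variables (n : nat) (K : numFieldType).
Implicit Types (a b : series n K) (c : category).

(* Absolute convergence on a polydisc of radius r: the partial sums of
   \sum_m |a m| r^|m| are bounded.  Germs at 0 of analytic functions are
   represented by their Taylor series, i.e. by the convergent series. *)
Definition convergent a : Prop :=
  exists r C : K, 0 < r /\
    forall d, \sum_(m : 'X_{1..n < d}) `|a m| * r ^+ mdeg m <= C.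

Definition germs c : {pred series n K} := fun a =>
  `[< match c with Formal => True | Analytic => convergent a end >].

Lemma convergent_lin (t : K) a b :
  convergent a -> convergent b -> convergent (t *: a + b).
Proof.
move=> [r [A [r0 Ha]]] [s [B [s0 Hb]]].
have [q [q0 qr qs]] : exists q : K, [/\ 0 < q, q <= r & q <= s].
  have /orP[rs|sr] : (r >=< s)%O by rewrite real_comparable ?gtr0_real.
  - by exists r.
  - by exists s.
exists q, (`|t| * A + B); split=> // d.
apply: le_trans (lerD (ler_wpM2l (normr_ge0 t) (Ha d)) (Hb d)).
rewrite mulr_sumr -big_split /=; apply: ler_sum => m _.
have qX (u : K) : q <= u -> q ^+ mdeg m <= u ^+ mdeg m.
  by move=> qu; apply: lerXn2r; rewrite ?nnegrE ?(ltW q0) ?(le_trans (ltW q0)).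
have ab : `|(t *: a + b) m| <= `|t| * `|a m| + `|b m|.
  by rewrite -normrM; apply: ler_normD.
apply: le_trans (ler_wpM2r (exprn_ge0 _ (ltW q0)) ab) _.
by rewrite mulrDl -mulrA lerD ?ler_wpM2l ?qX.
Qed.

Lemma germs_submod_closed c : submod_closed (germs c).
Proof.
split=> [|t a b]; rewrite ?unfold_in /germs.
  apply/asboolP; case: c => //; exists 1, 0; split=> // d.
  by rewrite big1 // => m _; rewrite normr0 mul0r.
move=> /asboolP aG /asboolP bG; apply/asboolP; case: c aG bG => //.
exact: convergent_lin.
Qed.

HB.instance Definition _ c :=
  GRing.isSubmodClosed.Build K (series n K) (germs c) (germs_submod_closed c).

Definition jacobian_ideal c (f : series n K) : {pred series n K} := fun g =>
  `[< exists2 a : 'I_n -> series n K,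
        forall i, a i \in germs c & g = \sum_i a i * partial i f >].

Lemma jacobian_ideal_submod_closed c f : submod_closed (jacobian_ideal c f).
Proof.
split=> [|t g h]; rewrite ?unfold_in /jacobian_ideal.
  apply/asboolP; exists (fun=> 0) => [i|]; first exact: rpred0.
  by rewrite big1 // => i _; rewrite mul0r.
move=> /asboolP[a aG ->] /asboolP[b bG ->]; apply/asboolP.
exists (fun i => t *: a i + b i) => [i|]; first by rewrite rpredD ?rpredZ.
rewrite scaler_sumr -big_split; apply: eq_bigr => i _.
by rewrite mulrDl scalerAl.
Qed.

HB.instance Definition _ c f := GRing.isSubmodClosed.Build K (series n K)
  (jacobian_ideal c f) (jacobian_ideal_submod_closed c f).

Definition finite_codimension c (f : series n K) : Prop :=
  finite_dimensional (subquot (germs c) (jacobian_ideal c f)).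

(* Vector fields are given by their components. *)
Definition Lie (X : 'I_n -> series n K) a : series n K :=
  \sum_i X i * partial i a.

Definition euler_field (w : 'I_n -> nat) : 'I_n -> series n K :=
  fun i => (w i)%:R *: poly_series 'X_i.

Definition quasihomogeneous (w : 'I_n -> nat) (d : int) a : Prop :=
  Lie (euler_field w) a = d%:~R *: a.

End Germs.

(* A form is the family of its coefficients in the basis of the
   dx_I = dx_i1 /\ ... /\ dx_ik, for I = {i1 < ... < ik}; all degrees are
   allowed at once, and [Omega c k] singles out the k-forms. *)
Notation form n K := {ffun {set 'I_n} -> series n K}.

Section Forms.
Variables (n : nat) (K : numFieldType).
Implicit Types (f a : series n K) (u v : form n K) (c : category).
Implicit Types (k : nat) (p : int) (I J : {set 'I_n}).

Definition Omega c k : {pred form n K} := fun u =>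
  [forall I, (u I \in germs c) && ((u I != 0) ==> (#|I| == k))].

Lemma Omega_submod_closed c k : submod_closed (Omega c k).
Proof.
split=> [|t u v]; rewrite ?unfold_in /Omega.
  by apply/forallP => I; rewrite ffunE rpred0 eqxx.
move=> /forallP uO /forallP vO; apply/forallP => I.
have /andP[uG uk] := uO I; have /andP[vG vk] := vO I.
rewrite !ffunE rpredD ?rpredZ //=; apply/implyP; apply: contraNT => Ik.
move: uk vk; rewrite (negbTE Ik) !implybF !negbK => /eqP -> /eqP ->.
by rewrite scaler0 addr0.
Qed.

HB.instance Definition _ c k := GRing.isSubmodClosed.Build K (form n K)
  (Omega c k) (Omega_submod_closed c k).

(* The number of inversions in the concatenation of I and J. *)
Definition inversions I J : nat :=
  #|[set x : 'I_n * 'I_n | [&& x.1 \in I, x.2 \in J & (x.2 < x.1)%N]]|.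

Definition wedge u v : form n K :=
  [ffun J : {set 'I_n} => \sum_(I : {set 'I_n} | I \subset J)
     (-1) ^+ inversions I (J :\: I) * (u I * v (J :\: I))].

Definition fmul a u : form n K := [ffun I : {set 'I_n} => a * u I].

Definition function_form a : form n K :=
  [ffun I : {set 'I_n} => if I == set0 then a else 0].

Definition dx (i : 'I_n) : form n K := [ffun I : {set 'I_n} => (I == [set i])%:R].

Definition diff u : form n K :=
  \sum_i wedge (dx i) [ffun I : {set 'I_n} => partial i (u I)].

Definition interior (X : 'I_n -> series n K) u : form n K :=
  [ffun I : {set 'I_n} => \sum_(i : 'I_n | i \notin I)
     (-1) ^+ inversions [set i] I * (X i * u (i |: I))].

Definition volume : form n K := [ffun I : {set 'I_n} => (I == [set: 'I_n])%:R].

Definition sigma (w : 'I_n -> nat) : form n K :=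
  interior (euler_field K w) volume.

Definition df_wedge f u : form n K := wedge (diff (function_form f)) u.

Definition twisted_diff f p k u : form n K :=
  fmul f (diff u) - (k%:Z - p)%:~R *: df_wedge f u.

Lemma wedge_linear u : linear (wedge u).
Proof.
move=> t v v'; apply/ffunP => J; rewrite !ffunE scaler_sumr -big_split /=.
by apply: eq_bigr => I _; rewrite !ffunE mulrDr -scalerAr mulrDr -scalerAr.
Qed.

HB.instance Definition _ u := GRing.isLinear.Build K (form n K) (form n K)
  *:%R (wedge u) (wedge_linear u).

Lemma fmul_linear a : linear (fmul a).
Proof.
by move=> t u v; apply/ffunP => J; rewrite !ffunE mulrDr -scalerAr.
Qed.

HB.instance Definition _ a := GRing.isLinear.Build K (form n K) (form n K)
  *:%R (fmul a) (fmul_linear a).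

Lemma diff_linear : linear diff.
Proof.
move=> t u v; rewrite /diff scaler_sumr -big_split; apply: eq_bigr => i _ /=.
rewrite -linearP; congr wedge; apply/ffunP => I.
by rewrite !ffunE linearP.
Qed.

HB.instance Definition _ := GRing.isLinear.Build K (form n K) (form n K)
  *:%R diff diff_linear.

Lemma df_wedge_linear f : linear (df_wedge f).
Proof. by move=> t u v; rewrite /df_wedge linearP. Qed.

HB.instance Definition _ f := GRing.isLinear.Build K (form n K) (form n K)
  *:%R (df_wedge f) (df_wedge_linear f).

Lemma twisted_diff_linear f p k : linear (twisted_diff f p k).
Proof.
move=> t u v; rewrite /twisted_diff; set s := _%:~R.
rewrite (linearP diff) (linearP (fmul f)) (linearP (df_wedge f)) scalerDr.
by rewrite scalerBr !scalerA (mulrC s) opprD addrACA.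
Qed.

HB.instance Definition _ f p k := GRing.isLinear.Build K (form n K) (form n K)
  *:%R (twisted_diff f p k) (twisted_diff_linear f p k).

Lemma image_submod_closed (L : {linear form n K -> form n K}) c k :
  submod_closed
    ((fun u => `[< exists2 v, v \in Omega c k & u = L v >]) : {pred form n K}).
Proof.
split=> [|t u v]; rewrite ?unfold_in.
  by apply/asboolP; exists 0; rewrite ?rpred0 ?raddf0.
move=> /asboolP[u' uO ->] /asboolP[v' vO ->]; apply/asboolP.
by exists (t *: u' + v'); rewrite ?linearP ?rpredD ?rpredZ.
Qed.

Definition cocycles c f p k : {pred form n K} := fun u =>
  (u \in Omega c k) && (twisted_diff f p k u == 0).

Lemma cocycles_submod_closed c f p k : submod_closed (cocycles c f p k).
Proof.
split=> [|t u v]; first by apply/andP; rewrite rpred0 raddf0.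
move=> /andP[uO /eqP u0] /andP[vO /eqP v0]; apply/andP.
rewrite rpredD ?rpredZ //= twisted_diff_linear u0 v0.
by rewrite scaler0 addr0.
Qed.

HB.instance Definition _ c f p k := GRing.isSubmodClosed.Build K (form n K)
  (cocycles c f p k) (cocycles_submod_closed c f p k).

Definition coboundaries c f p k : {pred form n K} := fun u =>
  match k with
  | 0 => u == 0
  | k'.+1 => `[< exists2 v, v \in Omega c k' & u = twisted_diff f p k' v >]
  end.

Lemma coboundaries_submod_closed c f p k : submod_closed (coboundaries c f p k).
Proof.
case: k => [|k]; last exact: (image_submod_closed (twisted_diff f p k)).
split=> [|t u v]; rewrite ?unfold_in /coboundaries ?eqxx //.
by move=> /eqP -> /eqP ->; rewrite scaler0 addr0.
Qed.

HB.instance Definition _ c f p k := GRing.isSubmodClosed.Build K (form n K)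
  (coboundaries c f p k) (coboundaries_submod_closed c f p k).

Definition cohomology c f p k : lmodType K :=
  subquot (cocycles c f p k) (coboundaries c f p k).

Definition quasihomogeneous_sigma (w : 'I_n -> nat) (d : int) :
    {pred form n K} := fun u =>
  `[< exists2 h : {mpoly K[n]}, quasihomogeneous w d (poly_series h)
        & u = fmul (poly_series h) (sigma w) >].

Lemma quasihomogeneous_sigma_submod_closed w d :
  submod_closed (quasihomogeneous_sigma w d).
Proof.
have polyP t (g h : {mpoly K[n]}) :
    poly_series (t *: g + h) = t *: poly_series g + poly_series h.
  by apply/funext => m; rewrite /poly_series mcoeffD mcoeffZ.
split=> [|t u v]; rewrite ?unfold_in.
  have p0 : poly_series (0 : {mpoly K[n]}) = 0.
    by apply/funext => m; apply: mcoeff0.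
  apply/asboolP; exists 0; rewrite p0.
    rewrite /quasihomogeneous /Lie scaler0 big1 // => i _.
    by rewrite raddf0 mulr0.
  by apply/ffunP => I; rewrite !ffunE mul0r.
move=> /asboolP[g gq ->] /asboolP[h hq ->]; apply/asboolP.
exists (t *: g + h); rewrite polyP; last first.
  by apply/ffunP => I; rewrite !ffunE mulrDl scalerAl.
rewrite /quasihomogeneous scalerDr -hq scalerA mulrC -scalerA -gq /Lie.
rewrite scaler_sumr -big_split; apply: eq_bigr => i _.
by rewrite linearP mulrDr scalerAr.
Qed.

HB.instance Definition _ w d := GRing.isSubmodClosed.Build K (form n K)
  (quasihomogeneous_sigma w d) (quasihomogeneous_sigma_submod_closed w d).

Definition df_d c f k : {pred form n K} := fun u =>
  `[< exists2 v, v \in Omega c k & u = df_wedge f (diff v) >].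

Definition df_df c f k : {pred form n K} := fun u =>
  `[< exists2 v, v \in Omega c k & u = df_wedge f (diff (fmul f v)) >].

Lemma df_d_submod_closed c f k : submod_closed (df_d c f k).
Proof. exact: (image_submod_closed (df_wedge f \o diff)). Qed.

Lemma df_df_submod_closed c f k : submod_closed (df_df c f k).
Proof. exact: (image_submod_closed (df_wedge f \o (diff \o fmul f))). Qed.

HB.instance Definition _ c f k := GRing.isSubmodClosed.Build K (form n K)
  (df_d c f k) (df_d_submod_closed c f k).

HB.instance Definition _ c f k := GRing.isSubmodClosed.Build K (form n K)
  (df_df c f k) (df_df_submod_closed c f k).

End Forms.

(* Main.v *)
Require Import Defs.
From HB Require Import structures.
From mathcomp Require Import all_boot all_order all_algebra.
From mathcomp Require Import boolp reals complex mpoly.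

Set Implicit Arguments.
Unset Strict Implicit.
Unset Printing Implicit Defensive.

Import Order.TTheory GRing.Theory Num.Theory.

Local Open Scope ring_scope.

(** Write [L] for the Lie derivative along the Euler field [W].  It acts on the
    monomial forms by multiplication with their weight, so [L + t] is
    invertible on forms all of whose weights are greater than [-t]; the inverse
    divides coefficients by positive integers, hence preserves convergence.
    The weights of [dx_i] being positive, this covers [L] in every degree
    [k >= 1].  By Cartan's formula [L = d iW + iW d], the operator [L] commutes
    with [d], and [L (df /\ u) = df /\ (L + N) u].

    The only other input is division by [df]: in degree [0 < k < n], a form
    [u] with [df /\ u = 0] is [df /\ v] ([division]).  By finite codimension
    and homogeneity, a power of each coordinate is a polynomial combination of
    the partial derivatives ([pow_in_jacobian_ideal]).  Contraction with the
    coefficients of these combinations lowers the degree of a cocycle at the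
    price of working modulo one more power, until no degree is left.  All
    operations used are multiplications by polynomials and truncations or
    shifts of coefficients, so that germs stay germs in either category.

    Let [u] be a cocycle of degree [n - 1], that is [f du = df /\ u].  Since
    [df /\ iW (du) = N f du], division gives
    [u = iW (du) / N + df /\ b].  With [b = L x], the top form
    [v = du / N - df /\ dx] satisfies [L v = N v], hence [v = h omega] with
    [h] a polynomial of weight [N - sum w], and Cartan's formula turns the
    expression of [u] into [h sigma + df /\ d (iW x) + N f dx]
    ([cocycle_decomposition]).

    Conversely let [h sigma + df /\ dg = f dx] ([coboundary_decomposition]).
    Applying [d] gives [N h omega = df /\ dx], which lies both in the kernel
    and in the image of [L - N]; the latter being diagonal, [h = 0].  Then
    [dx = df /\ m] and [dg = f m + df /\ p] by division, whence
    [L dx = df /\ d (N p + iW m)].  Taking [b] with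
    [(L + N) b = N p + iW m], the form [dx - df /\ db] is killed by [L], so
    that [df /\ dg = f dx = f df /\ db = df /\ d (f b)]. *)

Local Notation form n K := {ffun {set 'I_n} -> series n K}.

(** * Maps of subquotients induced by inclusions *)

Section NaturalMaps.
Variables (K : fieldType) (V : lmodType K).

Lemma natural_map_exists (Z1 Z2 B2 : submodClosed V) :
  {subset Z1 <= Z2} ->
  exists g : {linear subspace Z1 -> subquot Z2 B2}, natural_map g.
Proof.
move=> sZ.
pose incl (z : subspace Z1) : subspace Z2 := exist _ (sval z) (sZ _ (svalP z)).
have incl_lin : linear incl by move=> t x y; apply: val_inj.
pose inclL := GRing.isLinear.Build K (subspace Z1) (subspace Z2) *:%R incl incl_lin.
pose i : {linear subspace Z1 -> subspace Z2} := HB.pack incl inclL.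
by exists (@proj K V Z2 B2 \o i) => z; exists (incl z).
Qed.

Lemma natural_quotient_map_exists (Z1 B1 Z2 B2 : submodClosed V) :
  {subset Z1 <= Z2} -> {subset B1 <= B2} ->
  exists g : {linear subquot Z1 B1 -> subquot Z2 B2}, natural_quotient_map g.
Proof.
move=> sZ sB; have [g gE] := natural_map_exists B2 sZ.
have g_eq x y : proj B1 x = proj B1 y -> g x = g y.
  move=> /proj_eq /sB; have [x2 xE ->] := gE x; have [y2 yE ->] := gE y.
  by rewrite -xE -yE => ?; apply/proj_eq.
have [h hE] : exists h : subquot Z1 B1 -> subquot Z2 B2,
    forall z, h (proj B1 z) = g z.
  exists (fun q => g (sval (cid (proj_surj q)))) => z.
  by case: cid => z' /= /esym /g_eq.
have h_lin : linear h.
  move=> t p q; have [x ->] := proj_surj p; have [y ->] := proj_surj q.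
  by rewrite -linearP !hE linearP.
pose hL := GRing.isLinear.Build K _ _ *:%R h h_lin.
exists (HB.pack h hL : {linear _ -> _}) => z /=.
by have [z2 ? gz] := gE z; exists z2; rewrite ?hE.
Qed.

Lemma direct_sum_bijective (E F H : lmodType K)
    (iE : {linear E -> H}) (iF : {linear F -> H}) :
  (forall x y, iE x + iF y = 0 -> x = 0 /\ y = 0) ->
  (forall z, exists x : E * F, z = iE x.1 + iF x.2) ->
  bijective (fun x : E * F => iE x.1 + iF x.2).
Proof.
move=> inj0 /choice[inv invE]; exists inv => [x|z]; last by rewrite -invE.
have /eqP := invE (iE x.1 + iF x.2).
rewrite -subr_eq0 opprD addrACA -!linearB => /eqP/inj0[].
case: x (inv _) => x1 x2 [y1 y2] /= /eqP + /eqP.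
by rewrite !subr_eq0 => /eqP -> /eqP ->.
Qed.

End NaturalMaps.

(** * Coefficients and derivatives of power series *)

Section Series.
Variables (n : nat) (K : comNzRingType).
Implicit Types (a b : series n K) (m : 'X_{1..n}) (i j : 'I_n).

Lemma seriesDE a b m : (a + b) m = a m + b m. Proof. by []. Qed.
Lemma seriesNE a m : (- a) m = - a m. Proof. by []. Qed.
Lemma series0E m : (0 : series n K) m = 0. Proof. by []. Qed.
Lemma seriesZE t a m : (t *: a) m = t * a m. Proof. by []. Qed.
Lemma series_sumE I (r : seq I) P (F : I -> series n K) m :
  (\sum_(k <- r | P k) F k) m = \sum_(k <- r | P k) F k m.
Proof. by elim/big_rec2: _ => // k x y _ <-. Qed.
Lemma partialE i a m : partial i a m = a (m + U_(i))%MM *+ (m i).+1.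
Proof. by []. Qed.

Lemma partial0 i : partial i (0 : series n K) = 0.
Proof. exact: (raddf0 (partial i)). Qed.

Lemma partialN i a : partial i (- a) = - partial i a.
Proof. exact: (raddfN (partial i)). Qed.

Lemma partialC i j a : partial i (partial j a) = partial j (partial i a).
Proof.
apply/funext => m; rewrite !partialE -!mulrnA !mnmDE !mnm1E -!addmA (addmC U_(i)%MM).
congr (_ *+ _); rewrite eq_sym; case: eqP => [->|_] //=.
by rewrite !addn0 mulnC.
Qed.

Lemma mul_truncationE a b (p q : {mpoly K[n]}) m :
    (forall k : 'X_{1..n}, (mdeg k <= mdeg m)%N -> p@_k = a k) ->
    (forall k : 'X_{1..n}, (mdeg k <= mdeg m)%N -> q@_k = b k) ->
  (a * b) m = (p * q)@_m.
Proof. exact: series_mulE. Qed.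

Lemma partialM i a b : partial i (a * b) = partial i a * b + a * partial i b.
Proof.
apply/funext => m; pose d := (mdeg m).+2.
have TE u k : (mdeg k <= (mdeg m).+1)%N -> (truncation d u)@_k = u k.
  by move=> km; apply: truncationE.
have dTE u k : (mdeg k <= mdeg m)%N -> (truncation d u)^`M(i)@_k = partial i u k.
  by move=> km; rewrite mcoeff_deriv TE // mdegD mdeg1 addn1.
rewrite seriesDE partialE.
rewrite (@mul_truncationE a b (truncation d a) (truncation d b)); first last.
- by move=> k km; apply: TE; apply: leq_trans km _; rewrite mdegD mdeg1 addn1.
- by move=> k km; apply: TE; apply: leq_trans km _; rewrite mdegD mdeg1 addn1.
rewrite -mcoeff_deriv mderivM mcoeffD; congr (_ + _); symmetry; apply: mul_truncationE => k km;
  rewrite ?dTE ?TE //; exact: leqW.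
Qed.

Lemma poly_seriesD p q :
  poly_series (p + q) = poly_series p + poly_series q :> series n K.
Proof. by apply/funext => m; apply: mcoeffD. Qed.

Lemma poly_seriesZ t p : poly_series (t *: p) = t *: poly_series p :> series n K.
Proof. by apply/funext => m; apply: mcoeffZ. Qed.

Lemma partial_poly_series i p :
  partial i (poly_series p) = poly_series p^`M(i) :> series n K.
Proof. by apply/funext => m; rewrite partialE /poly_series mcoeff_deriv. Qed.

Lemma seriesME a b m : (a * b) m =
  \sum_(k : 'X_{1..n < (mdeg m).+1, (mdeg m).+1} | m == (k.1 + k.2)%MM)
    a k.1 * b k.2.
Proof. by []. Qed.

Lemma monomial_mulE (e : 'X_{1..n}) a m :
  (poly_series 'X_[e] * a) m = if (e <= m)%MM then a (m - e)%MM else 0.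
Proof.
rewrite (@mul_truncationE (poly_series 'X_[e]) a 'X_[e]
  (truncation (mdeg m).+1 a)) //; last first.
  by move=> k km; apply: truncationE.
case: ifPn => [le_em|nle_em].
  have -> p : ('X_[e] * p)@_m = p@_(m - e) :> K.
    by rewrite -{1}(submK le_em) mulrC addmC mcoeffMX.
  by rewrite truncationE // ltnS -{2}(submK le_em) mdegD leq_addr.
rewrite mcoeffM big1 // => k /eqP mk; rewrite mcoeffX.
case: eqP => [ek|]; last by rewrite mul0r.
by case/negP: nle_em; rewrite mk ek lem_addr.
Qed.

End Series.

(** * Exterior multiplication and contraction *)

Section Exterior.
Variables (n : nat) (K : numFieldType).
Implicit Types (f a b : series n K) (u v : form n K) (i j : 'I_n).
Implicit Types (X : 'I_n -> series n K) (I J : {set 'I_n}).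

Definition below i J : nat := #|[set y in J | (y < i)%N]|.

Lemma inversions_set1 i J : inversions [set i] J = below i J.
Proof.
rewrite /inversions /below.
rewrite -(card_imset (mem [set y in J | (y < i)%N]) (_ : injective (pair i))); last first.
  by move=> x y [].
apply: eq_card => -[x y]; rewrite inE /=; apply/idP/imsetP => [|[z]].
  by case/and3P => /set1P -> yJ yi; exists y; rewrite // inE yJ.
by rewrite inE => /andP[zJ zi] [-> ->]; rewrite set11 zJ.
Qed.

Lemma below_setD1 i j J : j \in J -> below i J = ((j < i) + below i (J :\ j))%N.
Proof.
move=> jJ; rewrite /below (cardsD1 j) !inE jJ /=; congr (_ + _)%N.
by apply: eq_card => y; rewrite !inE andbA.
Qed.

Lemma below_self i J : below i (J :\ i) = below i J.
Proof. by apply: eq_card => y; rewrite !inE; case: eqP => [->|]; rewrite ?ltnn ?andbF. Qed.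

Definition ext i u : form n K := [ffun J : {set 'I_n} =>
  if i \in J then (-1) ^+ below i J * u (J :\ i) else 0].

Definition contr i u : form n K := [ffun J : {set 'I_n} =>
  if i \in J then 0 else (-1) ^+ below i J * u (i |: J)].

Definition pderiv i u : form n K := [ffun J : {set 'I_n} => partial i (u J)].

Lemma ext_linear i : linear (ext i).
Proof.
move=> t u v; apply/ffunP => J; rewrite !ffunE; case: ifP => _.
  by rewrite mulrDr -scalerAr.
by rewrite scaler0 addr0.
Qed.

HB.instance Definition _ i := GRing.isLinear.Build K (form n K) (form n K)
  *:%R (ext i) (ext_linear i).

Lemma contr_linear i : linear (contr i).
Proof.
move=> t u v; apply/ffunP => J; rewrite !ffunE; case: ifP => _.
  by rewrite scaler0 addr0.
by rewrite mulrDr -scalerAr.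
Qed.

HB.instance Definition _ i := GRing.isLinear.Build K (form n K) (form n K)
  *:%R (contr i) (contr_linear i).

Lemma pderiv_linear i : linear (pderiv i).
Proof. by move=> t u v; apply/ffunP => J; rewrite !ffunE linearP. Qed.

HB.instance Definition _ i := GRing.isLinear.Build K (form n K) (form n K)
  *:%R (pderiv i) (pderiv_linear i).

Lemma ext_ext i j u : ext i (ext j u) = - ext j (ext i u).
Proof.
apply/ffunP => J; rewrite !ffunE !inE.
case: (eqVneq i j) => [->|ij] /=.
  by rewrite ?eqxx /= mulr0 if_same oppr0.
case iJ: (i \in J); case jJ: (j \in J); rewrite ?andbT ?andbF ?mulr0 ?oppr0 //=.
rewrite !mulrA -!exprD [in RHS](below_setD1 j iJ) (below_setD1 i jJ).
rewrite !setDDl (setUC [set i]) -mulNr; congr (_ * _).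
rewrite -!addnA (addnC (below j _)) !(exprD _ (_ < _)%N) -mulNr; congr (_ * _).
by case: ltngtP ij => [||/val_inj ->]; rewrite ?eqxx ?opprK.
Qed.

(** Together with [ext_ext], these are the canonical anticommutation relations;
    all identities of exterior calculus below follow from them and from the
    Leibniz rule for the coefficients. *)
Lemma contr_ext i j u :
  contr i (ext j u) = (if i == j then u else 0) - ext j (contr i u).
Proof.
apply/ffunP => J; rewrite !ffunE.
case: (eqVneq i j) => [->|ij] /=.
  rewrite setU11 !inE eqxx /=; case: ifP => jJ.
    rewrite setD1K // below_self mulrA -exprD addnn -mul2n exprM sqrrN.
    by rewrite !expr1n mul1r subrr.
  rewrite setU1K ?jJ // subr0 -(below_self _ (_ |: _)) setU1K ?jJ //.
  by rewrite mulrA -exprD addnn -mul2n exprM sqrrN !expr1n mul1r.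
rewrite !inE eq_sym (negbTE ij) ffunE sub0r /=.
case iJ: (i \in J); case jJ: (j \in J); rewrite ?andbT ?andbF ?mulr0 ?oppr0 //=.
rewrite (below_setD1 i jJ) (below_setD1 j (setU11 i J)) setU1K ?iJ //.
have -> : (i |: J) :\ j = i |: (J :\ j).
  by apply/setP => y; rewrite !inE; case: (eqVneq y j) => //= ->; rewrite eq_sym (negbTE ij).
rewrite !mulrA -!exprD -mulNr; congr (_ * _).
rewrite addnACA exprD (addnC (below j J)) -[RHS]mulN1r; congr (_ * _).
  by case: ltngtP ij => [||/val_inj ->]; rewrite ?eqxx ?opprK.
Qed.

Lemma pderiv_ext i j u : pderiv i (ext j u) = ext j (pderiv i u).
Proof.
apply/ffunP => J; rewrite !ffunE; case: ifP => _; last by rewrite partial0.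
by rewrite -signr_odd; case: odd; rewrite ?mulN1r ?mul1r ?partialN.
Qed.

Lemma contr_pderiv i j u : contr i (pderiv j u) = pderiv j (contr i u).
Proof.
apply/ffunP => J; rewrite !ffunE; case: ifP => _; first by rewrite partial0.
by rewrite -signr_odd; case: odd; rewrite ?mulN1r ?mul1r ?partialN.
Qed.

Lemma pderivC i j u : pderiv i (pderiv j u) = pderiv j (pderiv i u).
Proof. by apply/ffunP => J; rewrite !ffunE partialC. Qed.

Lemma ext_fmul i a u : ext i (fmul a u) = fmul a (ext i u).
Proof.
by apply/ffunP => J; rewrite !ffunE; case: ifP => _; rewrite ?mulr0 // mulrCA.
Qed.

Lemma contr_fmul i a u : contr i (fmul a u) = fmul a (contr i u).
Proof.
by apply/ffunP => J; rewrite !ffunE; case: ifP => _; rewrite ?mulr0 // mulrCA.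
Qed.

Lemma pderiv_fmul i a u :
  pderiv i (fmul a u) = fmul (partial i a) u + fmul a (pderiv i u).
Proof. by apply/ffunP => J; rewrite !ffunE partialM. Qed.

Lemma fmulA a b u : fmul a (fmul b u) = fmul (a * b) u.
Proof. by apply/ffunP => J; rewrite !ffunE mulrA. Qed.

Lemma fmulC a b u : fmul a (fmul b u) = fmul b (fmul a u).
Proof. by rewrite !fmulA mulrC. Qed.

Lemma fmul_suml (r : seq 'I_n) (P : pred 'I_n) X u :
  fmul (\sum_(i <- r | P i) X i) u = \sum_(i <- r | P i) fmul (X i) u.
Proof.
apply/ffunP => J; rewrite sum_ffunE !ffunE mulr_suml.
by apply: eq_bigr => i _; rewrite ffunE.
Qed.

(** Products with a one-form only involve singletons; this brings [diff] and
    [df_wedge] into terms of the operators [ext]. *)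
Lemma wedge_oneform X u :
  wedge [ffun J => \sum_i if J == [set i] then X i else 0] u =
  \sum_i fmul (X i) (ext i u).
Proof.
apply/ffunP => J; rewrite sum_ffunE !ffunE.
under eq_bigr => I _ do rewrite ffunE mulr_suml mulr_sumr.
rewrite exchange_big /=; apply: eq_bigr => i _; rewrite !ffunE.
case: ifPn => [iJ|niJ]; last first.
  rewrite mulr0 big1 // => I sIJ; case: eqP => [IE|]; last by rewrite mul0r mulr0.
  by move: sIJ; rewrite IE sub1set (negbTE niJ).
rewrite (bigD1 [set i]) ?sub1set //= eqxx big1 ?addr0 => [|I /andP[_ /negbTE ->]].
  by rewrite inversions_set1 below_self mulrCA.
by rewrite mul0r mulr0.
Qed.

Lemma dx_wedge i u : wedge (dx K i) u = ext i u.
Proof.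
pose X j : series n K := (j == i)%:R.
have -> : dx K i = [ffun J => \sum_j if J == [set j] then X j else 0].
  apply/ffunP => J; rewrite !ffunE (bigD1 i) //= big1 => [|j /negbTE ji].
    by rewrite /X eqxx addr0; case: eqP.
  by rewrite /X ji if_same.
rewrite wedge_oneform (bigD1 i) //= big1 => [|j /negbTE ji].
  by rewrite /X eqxx addr0; apply/ffunP => J; rewrite !ffunE mul1r.
by rewrite /X ji; apply/ffunP => J; rewrite !ffunE mul0r.
Qed.

Lemma diffE u : diff u = \sum_i ext i (pderiv i u).
Proof. by apply: eq_bigr => i _; rewrite dx_wedge. Qed.

Lemma df_wedgeE f u : df_wedge f u = \sum_i fmul (partial i f) (ext i u).
Proof.
rewrite -wedge_oneform /df_wedge diffE; congr wedge; apply/ffunP => J.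
rewrite sum_ffunE !ffunE; apply: eq_bigr => i _; rewrite !ffunE.
case: ifPn => [iJ|niJ].
  rewrite setD_eq0 subset1; case: (eqVneq J [set i]) => [->|Ji] /=.
    rewrite -below_self setDv /below (eq_card0 (A := _)) ?mul1r //.
    by move=> y; rewrite !inE.
  by case: (eqVneq J set0) iJ => [->|_ _]; rewrite ?inE // partial0 mulr0.
by case: eqP => // JE; rewrite JE set11 in niJ.
Qed.

Lemma interiorE X u : interior X u = \sum_i fmul (X i) (contr i u).
Proof.
apply/ffunP => J; rewrite sum_ffunE !ffunE big_mkcond; apply: eq_bigr => i _.
by rewrite !ffunE inversions_set1; case: (i \in J); rewrite /= ?mulr0 // mulrCA.
Qed.

Lemma interior_linear X : linear (interior X).
Proof.
move=> t u v; rewrite !interiorE scaler_sumr -big_split.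
by apply: eq_bigr => i _; rewrite !linearP.
Qed.

HB.instance Definition _ X := GRing.isLinear.Build K (form n K) (form n K)
  *:%R (interior X) (interior_linear X).

Lemma interior_fmul X a u : interior X (fmul a u) = fmul a (interior X u).
Proof.
rewrite !interiorE linear_sum.
by apply: eq_bigr => i _; rewrite contr_fmul fmulC.
Qed.

Lemma df_wedge_fmul f a u : df_wedge f (fmul a u) = fmul a (df_wedge f u).
Proof.
rewrite !df_wedgeE linear_sum.
by apply: eq_bigr => i _; rewrite ext_fmul fmulC.
Qed.

Lemma antisym_sum0 (G : 'I_n -> 'I_n -> form n K) :
  (forall i j, G i j = - G j i) -> \sum_i \sum_j G i j = 0.
Proof.
move=> GN; set S := \sum_i _; have SN : S = - S.
  rewrite {1}/S exchange_big -sumrN; apply: eq_bigr => i _.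
  by rewrite -sumrN; apply: eq_bigr => j _.
have /eqP : (2 : K) *: S = 0 by rewrite scaler_nat mulr2n {1}SN addNr.
by rewrite scaler_eq0 pnatr_eq0 /= => /eqP.
Qed.

Lemma df_df_wedge f u : df_wedge f (df_wedge f u) = 0.
Proof.
rewrite !df_wedgeE.
under eq_bigr => i _ do rewrite !linear_sum /=.
apply: antisym_sum0 => i j.
by rewrite !ext_fmul fmulC ext_ext !linearN.
Qed.

Lemma diff_diff u : diff (diff u) = 0.
Proof.
rewrite !diffE.
under eq_bigr => i _ do rewrite !linear_sum /=.
by apply: antisym_sum0 => i j; rewrite !pderiv_ext ext_ext pderivC.
Qed.

Lemma diff_fmul a u : diff (fmul a u) = df_wedge a u + fmul a (diff u).
Proof.
rewrite !diffE df_wedgeE linear_sum -big_split; apply: eq_bigr => i _.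
by rewrite pderiv_fmul linearD /= !ext_fmul.
Qed.

Lemma diff_df_wedge f u : diff (df_wedge f u) = - df_wedge f (diff u).
Proof.
rewrite df_wedgeE linear_sum /=.
under eq_bigr => j _ do rewrite diff_fmul.
(* The Hessian of [f] is symmetric. *)
rewrite big_split /= [X in X + _](_ : _ = 0) ?add0r; last first.
  under eq_bigr => j _ do rewrite df_wedgeE.
  by apply: antisym_sum0 => i j; rewrite partialC ext_ext linearN.
rewrite diffE df_wedgeE.
under eq_bigr => j _ do rewrite diffE linear_sum /=.
under [in RHS]eq_bigr => j _ do rewrite !linear_sum /=.
rewrite -sumrN; apply: eq_bigr => j _; rewrite -sumrN; apply: eq_bigr => i _.
by rewrite pderiv_ext ext_ext linearN.
Qed.

Lemma interior_df_wedge X f u :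
  interior X (df_wedge f u) =
  fmul (\sum_i X i * partial i f) u - df_wedge f (interior X u).
Proof.
rewrite interiorE df_wedgeE interiorE df_wedgeE fmul_suml -sumrB.
under eq_bigr => i _ do rewrite !linear_sum /=.
rewrite [in RHS]sumrB; under [X in _ - X]eq_bigr => i _ do rewrite !linear_sum /=.
rewrite [X in _ - X]exchange_big -sumrB /=; apply: eq_bigr => i _.
rewrite -[X in X - _](_ : \sum_j (if i == j then fmul (X i * partial i f) u else 0) = _).
  rewrite -sumrB; apply: eq_bigr => j _.
  rewrite contr_fmul contr_ext !linearB /= ext_fmul (fmulC (X i)); congr (_ - _).
    by case: eqP => [<-|_]; rewrite ?fmulA 1?mulrC ?linear0.
  by rewrite fmulC.
by rewrite (bigD1 i) //= eqxx big1 ?addr0 // => j; rewrite eq_sym => /negbTE ->.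
Qed.

End Exterior.

(** * Germs *)

Section GermsClosure.
Variables (n : nat) (K : numFieldType).
Implicit Types (a b : series n K) (c : category) (i j : 'I_n) (m e : 'X_{1..n}).

Lemma geometric_sum_le2 d : \sum_(k < d) (2^-1 : K) ^+ k <= 2.
Proof.
suff -> : \sum_(k < d) (2^-1 : K) ^+ k = 2 - 2 * 2^-1 ^+ d.
  by rewrite gerBl mulr_ge0 ?exprn_ge0 ?invr_ge0.
elim: d => [|d IH]; first by rewrite big_ord0 expr0 mulr1 subrr.
rewrite big_ord_recr IH /= exprS mulrA divff ?pnatr_eq0 // mul1r.
by rewrite -addrA; congr (_ + _); rewrite mulr2n mulrDl mul1r opprD addrNK.
Qed.

Lemma sum_half_mdeg_le d :
  \sum_(m : 'X_{1..n < d}) (2^-1 : K) ^+ mdeg m <= 2 ^+ n.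
Proof.
have lt_md (m : 'X_{1..n < d}) i : (m i < d)%N.
  by apply: leq_ltn_trans (bmdeg m); rewrite mdegE (bigD1 i) //= leq_addr.
pose h (m : 'X_{1..n < d}) := [ffun i => Ordinal (lt_md m i)].
have h_inj : injective h.
  move=> m m' /ffunP hE; apply/val_inj/mnmP => i.
  by have := hE i; rewrite !ffunE => /(congr1 val).
pose G (g : {ffun 'I_n -> 'I_d}) := \prod_i (2^-1 : K) ^+ g i.
have -> : \sum_(m : 'X_{1..n < d}) (2^-1 : K) ^+ mdeg m =
          \sum_(g in h @: setT) G g.
  rewrite big_imset /=; last by move=> x y _ _; apply: h_inj.
  apply: eq_big => [m|m _]; first by rewrite inE.
  by rewrite mdegE -prodrXr; apply: eq_bigr => i _; rewrite ffunE.
apply: (@le_trans _ _ (\sum_g G g)).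
  rewrite [leRHS](bigID (mem (h @: setT))) lerDl sumr_ge0 // => g _.
  by apply: prodr_ge0 => i _; rewrite exprn_ge0 ?invr_ge0.
rewrite /G -(bigA_distr_bigA (fun _ (k : 'I_d) => (2^-1 : K) ^+ k)).
rewrite -[n in leRHS]card_ord -prodr_const; apply: ler_prod => i _.
by rewrite geometric_sum_le2 sumr_ge0 // => k _; rewrite exprn_ge0 ?invr_ge0.
Qed.

(** Up to halving the radius, bounded partial sums and bounded terms are the
    same condition, since the powers of [1/2] with exponents the degrees of
    all monomials have bounded sums.  The closure properties of convergent
    series thus reduce to bounds on single terms. *)
Lemma convergentP a : convergent a <->
  exists r C : K, 0 < r /\ forall m, `|a m| * r ^+ mdeg m <= C.
Proof.
split=> -[r [C [r0 aC]]].
  exists r, C; split=> // m; apply: le_trans (aC (mdeg m).+1).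
  rewrite (bigD1 (BMultinom (ltnSn (mdeg m)))) //= lerDl sumr_ge0 // => k _.
  by rewrite mulr_ge0 ?exprn_ge0 // ltW.
exists (r / 2), (C * 2 ^+ n); split=> [|d]; first by rewrite divr_gt0.
have C0 : 0 <= C by apply: le_trans (aC 0%MM); rewrite mulr_ge0 ?normr_ge0 ?exprn_ge0 ?(ltW r0).
apply: le_trans (ler_wpM2l C0 (sum_half_mdeg_le d)).
rewrite mulr_sumr; apply: ler_sum => m _.
by rewrite exprMn mulrA ler_wpM2r ?exprn_ge0 ?invr_ge0.
Qed.

Lemma germs_bound c a b :
  (forall r C : K, 0 < r -> (forall m, `|a m| * r ^+ mdeg m <= C) ->
     exists r' C' : K, 0 < r' /\ forall m, `|b m| * r' ^+ mdeg m <= C') ->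
  a \in germs c -> b \in germs c.
Proof.
move=> ab /asboolP aG; apply/asboolP; case: c aG => // /convergentP[r [C [r0 aC]]].
by apply/convergentP; apply: ab aC.
Qed.

Lemma germs_le c a b : (forall m, `|b m| <= `|a m|) ->
  a \in germs c -> b \in germs c.
Proof.
move=> ba; apply: germs_bound => r C r0 aC; exists r, C; split=> // m.
by apply: le_trans (aC m); rewrite ler_wpM2r ?exprn_ge0 ?(ltW r0).
Qed.

Lemma monomial_mul_germs c e a :
  a \in germs c -> poly_series 'X_[e] * a \in germs c.
Proof.
apply: germs_bound => r C r0 aC; exists r, (C * r ^+ mdeg e); split=> // m.
have re0 : 0 <= r ^+ mdeg e by rewrite exprn_ge0 ?(ltW r0).
rewrite monomial_mulE; case: ifP => [em|_].
  rewrite -{2}(submK em) mdegD exprD mulrA.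
  exact: ler_wpM2r.
rewrite normr0 mul0r mulr_ge0 //; apply: le_trans (aC 0%MM).
by rewrite mulr_ge0 ?normr_ge0 ?exprn_ge0 ?(ltW r0).
Qed.

Lemma poly_mul_germs c p a : a \in germs c -> poly_series p * a \in germs c.
Proof.
move=> aG; elim/mpolyind: p => [|t m p _ _ IH].
  have -> : poly_series 0 = 0 :> series n K by apply/funext => m; apply: mcoeff0.
  by rewrite mul0r rpred0.
by rewrite poly_seriesD poly_seriesZ mulrDl -scalerAl rpredD ?rpredZ ?monomial_mul_germs.
Qed.

Lemma poly_series_germs c p : (poly_series p : series n K) \in germs c.
Proof.
rewrite -[X in X \in _]mulr1; apply: poly_mul_germs.
apply/asboolP; case: c => //; apply/convergentP; exists 1, 1; split=> // m.
by rewrite expr1n mulr1 /GRing.one /= /series_one /poly_series mcoeff1; case: eqP => _; rewrite ?normr0 ?normr1.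
Qed.

Lemma shift_germs c e a :
  a \in germs c -> (fun m => a (m + e)%MM : K) \in germs c.
Proof.
apply: germs_bound => r C r0 aC; exists r, (C / r ^+ mdeg e); split=> // m.
rewrite ler_pdivlMr ?exprn_gt0 //.
by apply: le_trans (aC (m + e)%MM); rewrite mdegD exprD mulrA.
Qed.

Lemma partial_germs c i a : a \in germs c -> partial i a \in germs c.
Proof.
move/(shift_germs U_(i)%MM); apply: germs_bound => r C r0 aC.
(* Halving the radius absorbs the factor [m i + 1 <= 2 ^ mdeg m]. *)
exists (r / 2), C; split=> [|m]; first by rewrite divr_gt0.
apply: le_trans (aC m); rewrite partialE normrMn exprMn.
rewrite -(mulr_natr `|_|) -mulrA ler_wpM2l ?normr_ge0 //.
rewrite mulrCA -[leRHS]mulr1 ler_wpM2l ?exprn_ge0 ?(ltW r0) //.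
rewrite exprVn ler_pdivrMr ?exprn_gt0 // mul1r -natrX ler_nat.
apply: (@leq_trans (mdeg m).+1); last exact: ltn_expl.
by rewrite ltnS mdegE (bigD1 i) //= leq_addr.
Qed.

End GermsClosure.

(** * The spaces of forms *)

Section FormSpaces.
Variables (n : nat) (K : numFieldType) (c : category).
Implicit Types (f a b : series n K) (u v : form n K) (i j : 'I_n) (k : nat).

Lemma OmegaP k u : reflect
  (forall I, u I \in germs c /\ (#|I| != k -> u I = 0)) (u \in Omega c k).
Proof.
apply: (iffP forallP) => uO I.
  have /andP[uG uk] := uO I; split=> // Ik; apply/eqP.
  by apply: contraNT Ik; apply: (implyP uk).
have [-> u0] := uO I; apply/implyP; apply: contraNT => /u0 ->; exact: eqxx.
Qed.

Lemma ext_Omega i k u : u \in Omega c k -> ext i u \in Omega c k.+1.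
Proof.
move/OmegaP => uO; apply/OmegaP => I; rewrite ffunE.
case: ifP => [iI|_]; last by rewrite rpred0.
have [uG u0] := uO (I :\ i); split.
  by rewrite -signr_odd; case: odd; rewrite ?mulN1r ?mul1r ?rpredN.
by rewrite (cardsD1 i) iI eqSS => /u0 ->; rewrite mulr0.
Qed.

Lemma contr_Omega i k u : u \in Omega c k.+1 -> contr i u \in Omega c k.
Proof.
move/OmegaP => uO; apply/OmegaP => I; rewrite ffunE.
case: ifP => [_|iI]; first by rewrite rpred0.
have [uG u0] := uO (i |: I); split.
  by rewrite -signr_odd; case: odd; rewrite ?mulN1r ?mul1r ?rpredN.
by move: u0; rewrite cardsU1 iI eqSS => u0 /u0 ->; rewrite mulr0.
Qed.

Lemma contr_Omega0 i u : u \in Omega c 0 -> contr i u = 0.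
Proof.
move/OmegaP => uO; apply/ffunP => I; rewrite !ffunE; case: ifP => // _.
have [_ ->] := uO (i |: I); rewrite ?mulr0 // -lt0n.
by apply/card_gt0P; exists i; rewrite setU11.
Qed.

Lemma pderiv_Omega i k u : u \in Omega c k -> pderiv i u \in Omega c k.
Proof.
move/OmegaP => uO; apply/OmegaP => I; rewrite ffunE; have [uG u0] := uO I.
by split=> [|/u0 ->]; rewrite ?partial_germs ?partial0.
Qed.

Lemma fmul_Omega p k u : u \in Omega c k -> fmul (poly_series p) u \in Omega c k.
Proof.
move/OmegaP => uO; apply/OmegaP => I; rewrite ffunE; have [uG u0] := uO I.
by split=> [|/u0 ->]; rewrite ?poly_mul_germs ?mulr0.
Qed.

Lemma diff_Omega k u : u \in Omega c k -> diff u \in Omega c k.+1.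
Proof. by move=> uO; rewrite diffE rpred_sum // => i _; rewrite ext_Omega ?pderiv_Omega. Qed.

Lemma df_wedge_Omega (f : {mpoly K[n]}) k u :
  u \in Omega c k -> df_wedge (poly_series f) u \in Omega c k.+1.
Proof.
move=> uO; rewrite df_wedgeE rpred_sum // => i _.
by rewrite partial_poly_series fmul_Omega ?ext_Omega.
Qed.

Lemma interior_Omega (X : 'I_n -> {mpoly K[n]}) k u :
  u \in Omega c k.+1 -> interior (fun i => poly_series (X i)) u \in Omega c k.
Proof.
by move=> uO; rewrite interiorE rpred_sum // => i _; rewrite fmul_Omega ?contr_Omega.
Qed.

Lemma interior_Omega0 X u : u \in Omega c 0 -> interior X u = 0.
Proof.
by move=> uO; rewrite interiorE big1 // => i _; rewrite contr_Omega0 ?linear0.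
Qed.

Lemma Omega_gt k u : (n < k)%N -> u \in Omega c k -> u = 0.
Proof.
move=> nk /OmegaP uO; apply/ffunP => I; rewrite ffunE; have [_ ->] // := uO I.
by rewrite neq_ltn (leq_ltn_trans _ nk) // -[n in leqRHS]card_ord max_card.
Qed.

End FormSpaces.

(** * The Lie derivative along the Euler field *)

Section EulerField.
Variables (n : nat) (K : numFieldType) (w : 'I_n -> nat).
Implicit Types (f a b : series n K) (u v : form n K) (i j : 'I_n).
Implicit Types (c : category) (k t : nat) (m : 'X_{1..n}) (I : {set 'I_n}).

Local Notation W := (euler_field K w).

Definition mon_weight m : nat := \sum_i w i * m i.
Definition set_weight I : nat := \sum_(i in I) w i.

Lemma euler_fieldE : W = fun i => poly_series ((w i)%:R *: 'X_i).
Proof. by apply/funext => i; rewrite poly_seriesZ. Qed.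

Lemma X_partialE i a m : (poly_series 'X_i * partial i a) m = (m i)%:R * a m.
Proof.
rewrite monomial_mulE; case: ifPn => [/mnm_lepP/(_ i)|].
  rewrite mnm1E eqxx => mi; rewrite partialE submK; last first.
    by apply/mnm_lepP => j; rewrite mnm1E; case: eqP => // <-.
  by rewrite mnmBE mnm1E eqxx subn1 prednK // mulr_natl.
move=> niU; have -> : m i = 0%N.
  apply/eqP; apply: contraNT niU; rewrite -lt0n => mi.
  by apply/mnm_lepP => j; rewrite mnm1E; case: eqP => // <-.
by rewrite mul0r.
Qed.

Lemma Lie_eulerE a m : Lie W a m = (mon_weight m)%:R * a m.
Proof.
rewrite /Lie series_sumE natr_sum mulr_suml; apply: eq_bigr => i _.
by rewrite /euler_field -scalerAl seriesZE X_partialE natrM mulrA.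
Qed.

Lemma partial_euler i j : partial i (W j) = ((i == j) * w j)%:R *: (1 : series n K).
Proof.
rewrite euler_fieldE partial_poly_series linearZ poly_seriesZ /= mderivX mnm1E.
rewrite eq_sym poly_seriesZ; case: eqP => [->|_] /=; last first.
  by rewrite !scale0r scaler0.
rewrite scale1r mul1n; have -> : (U_(j) - U_(j) = 0 :> 'X_{1..n})%MM.
  by apply/mnmP => l; rewrite mnmBE subnn mnm0E.
by rewrite mpolyX0.
Qed.

(** The Lie derivative along [W] ([cartan]), written as a diagonal operator so
    that its eigenvalues, the weights of the monomial forms, are visible. *)
Definition lie u : form n K := [ffun I : {set 'I_n} =>
  (fun m => (mon_weight m + set_weight I)%:R * u I m) : series n K].

(** The field [W] is linear and diagonal: differentiating its components
    contributes the weights of the [dx_i], and differentiating the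
    coefficients contributes those of the monomials. *)
Lemma cartan u : diff (interior W u) + interior W (diff u) = lie u.
Proof.
rewrite !interiorE linear_sum -big_split /=.
have contr_diff j : contr j (diff u) = pderiv j u - diff (contr j u).
  rewrite !diffE linear_sum /= -[pderiv j u in RHS](_ : \sum_i (if j == i then pderiv i u else 0) = _).
    by rewrite -sumrB; apply: eq_bigr => i _; rewrite contr_ext contr_pderiv.
  by rewrite (bigD1 j) //= eqxx big1 ?addr0 // => i; rewrite eq_sym => /negbTE ->.
under eq_bigr => j _.
  rewrite diff_fmul contr_diff linearB /= addrA addrAC -addrA addrA addrK.
  rewrite df_wedgeE (bigD1 j) //= big1 => [|i /negbTE ij]; last first.
    by apply/ffunP => I; rewrite partial_euler ij !ffunE scale0r mul0r.
  over.
apply/ffunP => I; apply/funext => m; rewrite sum_ffunE series_sumE !ffunE.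
rewrite natrD mulrDl -Lie_eulerE /Lie series_sumE natr_sum mulr_suml.
rewrite [in RHS]addrC [X in X + _]big_mkcond -big_split /=.
apply: eq_bigr => j _; rewrite !ffunE addr0 partial_euler eqxx mul1n /=.
rewrite seriesDE; congr (_ + _); rewrite -scalerAl mul1r seriesZE.
case: ifP => jI; rewrite ?mulr0 // !inE eqxx /= setD1K // below_self mulrA -exprD.
by rewrite addnn -mul2n exprM sqrrN !expr1n mul1r.
Qed.

Lemma lie_linear : linear lie.
Proof. by move=> t u v; rewrite -!cartan !linearP scalerDr addrACA. Qed.

HB.instance Definition _ := GRing.isLinear.Build K (form n K) (form n K)
  *:%R lie lie_linear.

Lemma lie_diff u : lie (diff u) = diff (lie u).
Proof. by rewrite -!cartan linearD /= !diff_diff linear0 addr0 add0r. Qed.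

Definition lie_shift_inv t u : form n K := [ffun I : {set 'I_n} =>
  (fun m => u I m / (mon_weight m + set_weight I + t)%:R) : series n K].

Lemma lie_shift_invK t u : (forall I, (0 < set_weight I + t)%N \/ u I = 0) ->
  lie (lie_shift_inv t u) + t%:R *: lie_shift_inv t u = u.
Proof.
move=> ut; apply/ffunP => I; apply/funext => m.
rewrite !ffunE seriesDE seriesZE -mulrDl -natrD.
have [wt|->] := ut I; last by rewrite series0E mul0r mulr0.
by rewrite mulrC divfK // pnatr_eq0 -lt0n -addnA ltn_addl.
Qed.

Lemma lie_shift_inv_Omega c k t u :
  u \in Omega c k -> lie_shift_inv t u \in Omega c k.
Proof.
move/OmegaP => uO; apply/OmegaP => I; rewrite ffunE; have [uG u0] := uO I; split.
  apply: germs_le uG => m; rewrite normrM normfV normr_nat.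
  set d := (_ + _)%N; have [->|d0] := posnP d.
    by rewrite invr0 mulr0 normr_ge0.
  by rewrite ler_pdivrMr ?ltr0n // ler_peMr ?normr_ge0 ?ler1n.
by move/u0 => ->; apply/funext => m; rewrite series0E mul0r.
Qed.

(** A diagonal operator, here [lie - N], has no nilpotent part. *)
Lemma lie_sub_eq0 (N : K) u :
  lie (lie u - N *: u) = N *: (lie u - N *: u) -> lie u = N *: u.
Proof.
move=> uE; apply/ffunP => I; apply/funext => m.
move/ffunP/(_ I)/(congr1 (fun a : series n K => a m)): uE.
rewrite !(seriesZE, seriesDE, seriesNE, ffunE) /=.
move/eqP; rewrite -!mulrBl -subr_eq0 -mulrBl mulrA mulf_eq0 mulf_eq0 orbb.
by rewrite subr_eq0; case/orP => [/eqP -> // | /eqP ->]; rewrite !mulr0.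
Qed.

Lemma set_weight_gt0 c k u I : (forall i, 0 < w i)%N -> (0 < k)%N ->
  u \in Omega c k -> (0 < set_weight I)%N \/ u I = 0.
Proof.
move=> w0 k0 /OmegaP uO; have [->|/set0Pn[i iI]] := eqVneq I set0.
  by right; have [_ ->] := uO set0; rewrite // cards0 neq_ltn k0.
by left; rewrite /set_weight (bigD1 i) //= ltn_addr.
Qed.

Section Quasihomogeneous.
Variables (f : series n K) (N : nat).
Hypothesis fN : quasihomogeneous w N%:Z f.

Lemma interior_euler_df_wedge u : interior W (df_wedge f u) =
  N%:R *: fmul f u - df_wedge f (interior W u).
Proof.
rewrite interior_df_wedge -/(Lie W f) fN; congr (_ - _).
by apply/ffunP => I; rewrite !ffunE -scalerAl.
Qed.

(** Multiplication by [df] shifts the weights by the weight [N] of [df]. *)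
Lemma lie_df_wedge u :
  lie (df_wedge f u) = df_wedge f (lie u) + N%:R *: df_wedge f u.
Proof.
rewrite -!cartan interior_euler_df_wedge linearB linearZ /= diff_fmul.
rewrite !diff_df_wedge (linearN (interior W)) /= interior_euler_df_wedge.
rewrite (linearD (df_wedge f)) /=.
rewrite scalerDr !opprB opprK addrACA -[RHS]addrC -!addrA; congr (_ + _).
by rewrite [LHS]addrC -!addrA addNr addr0 addrC.
Qed.

End Quasihomogeneous.

End EulerField.

(** * Division by the differential *)

Section Division.
Variables (n : nat) (K : numFieldType) (c : category) (f : {mpoly K[n]}).
Variables (M : 'I_n -> nat) (A : 'I_n -> 'I_n -> {mpoly K[n]}).
Implicit Types (a b : series n K) (u v : form n K) (i j : 'I_n) (d k : nat).

Local Notation df := (df_wedge (poly_series f)).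
Local Notation pow i := ('X_[U_(i) *+ M i] : {mpoly K[n]}).

(** Coefficients in the ideal generated by the [x_i ^ M i] for [i < d], an ideal
    spanned by monomials; the condition leaves the cofactors implicit. *)
Definition in_pow_ideal d u : Prop :=
  forall I (m : 'X_{1..n}), (forall i, (i < d)%N -> (m i < M i)%N) -> u I m = 0.

Lemma in_pow_ideal_add d u v :
  in_pow_ideal d u -> in_pow_ideal d v -> in_pow_ideal d (u + v).
Proof. by move=> ud vd I m mM; rewrite ffunE seriesDE ud ?vd ?addr0. Qed.

Lemma in_pow_ideal_opp d u : in_pow_ideal d u -> in_pow_ideal d (- u).
Proof. by move=> ud I m mM; rewrite ffunE seriesNE ud ?oppr0. Qed.

Lemma in_pow_ideal_sum d (F : 'I_n -> form n K) :
  (forall i, in_pow_ideal d (F i)) -> in_pow_ideal d (\sum_i F i).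
Proof.
move=> Fd; apply: (big_ind (in_pow_ideal d)) => //; last exact: in_pow_ideal_add.
by move=> I m _; rewrite ffunE.
Qed.

Lemma in_pow_ideal_fmul d a u : in_pow_ideal d u -> in_pow_ideal d (fmul a u).
Proof.
move=> ud I m mM; rewrite ffunE seriesME big1 // => -[k l] /= /eqP mE.
rewrite ud ?mulr0 // => i /mM; apply: leq_ltn_trans.
by move/mnmP/(_ i): mE => ->; rewrite mnmDE leq_addl.
Qed.

Lemma in_pow_ideal_ext d i u : in_pow_ideal d u -> in_pow_ideal d (ext i u).
Proof.
move=> ud I m mM; rewrite ffunE; case: ifP => // _.
by rewrite -signr_odd; case: odd; rewrite ?mulN1r ?mul1r ?seriesNE ud ?oppr0.
Qed.

Lemma in_pow_ideal_contr d i u : in_pow_ideal d u -> in_pow_ideal d (contr i u).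
Proof.
move=> ud I m mM; rewrite ffunE; case: ifP => // _.
by rewrite -signr_odd; case: odd; rewrite ?mulN1r ?mul1r ?seriesNE ud ?oppr0.
Qed.

Lemma in_pow_ideal_df d u : in_pow_ideal d u -> in_pow_ideal d (df u).
Proof.
move=> ud; rewrite df_wedgeE; apply: in_pow_ideal_sum => i.
exact/in_pow_ideal_fmul/in_pow_ideal_ext.
Qed.

Lemma in_pow_ideal_interior d X u :
  in_pow_ideal d u -> in_pow_ideal d (interior X u).
Proof.
move=> ud; rewrite interiorE; apply: in_pow_ideal_sum => i.
exact/in_pow_ideal_fmul/in_pow_ideal_contr.
Qed.

(** The powers of the coordinates form a regular sequence: membership in
    [in_pow_ideal i] only constrains the exponents of the variables before
    [i], and these do not see a multiplication by a power of the [i]-th. *)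
Lemma in_pow_ideal_regular i u :
  in_pow_ideal i (fmul (poly_series (pow i)) u) -> in_pow_ideal i u.
Proof.
move=> ui I m mM; have := ui I (m + U_(i) *+ M i)%MM; rewrite ffunE monomial_mulE.
rewrite lem_addl addmK; apply=> j ji.
by rewrite mnmDE mulmnE mnm1E -val_eqE gtn_eqF // mul0n addn0 mM.
Qed.

(** The only quotients ever formed are shifts of coefficients, which preserve
    convergence. *)
Lemma in_pow_ideal_split i k u : u \in Omega c k -> in_pow_ideal i.+1 u ->
  exists2 r, r \in Omega c k & in_pow_ideal i (u - fmul (poly_series (pow i)) r).
Proof.
move=> /OmegaP uO ui; set e := (U_(i) *+ M i)%MM.
exists [ffun I : {set 'I_n} => (fun m => u I (m + e)%MM) : series n K].
  apply/OmegaP => I; rewrite ffunE; have [uG u0] := uO I.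
  by split=> [|/u0 ->]; first exact: shift_germs.
move=> I m mM; rewrite !ffunE seriesDE seriesNE monomial_mulE.
case: ifPn => [em|nem]; first by rewrite submK ?subrr.
rewrite subr0 ui // => j; rewrite ltnS leq_eqVlt => /orP[/eqP/val_inj ->|]; last exact: mM.
rewrite ltnNge; apply: contra nem => Mi; apply/mnm_lepP => l.
by rewrite mulmnE mnm1E; case: eqP => [<-|_]; rewrite ?mul1n ?mul0n.
Qed.

Hypothesis powE : forall i, poly_series (pow i) =
  \sum_j poly_series (A i j) * partial j (poly_series f).

(** Contraction with the [d]-th row of [A] is a homotopy from multiplication by
    the [d]-th power to zero.  It turns a cocycle of degree [k] modulo [d]
    powers into a cocycle of degree [k - 1] modulo [d + 1] powers, and a
    primitive of the latter into one of the former because the powers form a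
    regular sequence.  The bound [k + d < n] ensures that a further power is
    available until the degree is exhausted. *)
Lemma division_mod k d u : (k + d < n)%N -> u \in Omega c k ->
  in_pow_ideal d (df u) ->
  match k with
  | 0 => in_pow_ideal d u
  | k'.+1 => exists2 v, v \in Omega c k' & in_pow_ideal d (u - df v)
  end.
Proof.
elim: k d u => [|k IH] d u lt_n uO ud.
  pose i := Ordinal lt_n; apply: (@in_pow_ideal_regular i).
  rewrite powE -[X in in_pow_ideal _ X](subrK (df (interior (fun j => poly_series (A i j)) u))).
  rewrite -interior_df_wedge (interior_Omega0 _ uO) linear0 addr0.
  exact: in_pow_ideal_interior.
have lt_dn : (d < n)%N by apply: leq_ltn_trans lt_n; rewrite leq_addl.
pose i := Ordinal lt_dn; pose iA := interior (fun j => poly_series (A i j)).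
have iAO : iA u \in Omega c k by apply: interior_Omega.
have powu : fmul (poly_series (pow i)) u = iA (df u) + df (iA u).
  by rewrite /iA interior_df_wedge -powE subrK.
have iAud : in_pow_ideal d (iA (df u)) by apply: in_pow_ideal_interior.
have iAd : in_pow_ideal d.+1 (df (iA u)).
  have -> : df (iA u) = fmul (poly_series (pow i)) u - iA (df u).
    by rewrite powu addrAC addrN add0r.
  apply: in_pow_ideal_add.
    move=> I m mM; rewrite ffunE monomial_mulE; case: ifPn => // /mnm_lepP/(_ i).
    by rewrite mulmnE mnm1E eqxx mul1n leqNgt mM //= ltnSn.
  by apply: in_pow_ideal_opp => I m mM; apply: iAud => j jd; apply: mM; exact: leqW.
have [v dv0 [r rO ir]] : exists2 v, df (df v) = 0 & exists2 r, r \in Omega c k &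
    in_pow_ideal d (iA u - df v - fmul (poly_series (pow i)) r).
  have := IH d.+1 _ _ iAO iAd; rewrite addnS -addSn => /(_ lt_n).
  case: (k) iAO => [|k'] iAO => [iA0|[v vO iv]].
    have [r rO ir] := @in_pow_ideal_split i _ _ iAO iA0.
    have df0 : df 0 = 0 := linear0 _.
    by exists 0; [rewrite !df0|exists r; rewrite ?df0 ?subr0].
  exists v; first exact: df_df_wedge.
  by apply: (@in_pow_ideal_split i); rewrite ?rpredB ?df_wedge_Omega.
exists r => //; apply: (@in_pow_ideal_regular i).
rewrite linearB /= powu -df_wedge_fmul -addrA.
apply: in_pow_ideal_add => //; move/in_pow_ideal_df: ir.
by rewrite !linearB /= dv0 subr0.
Qed.

Lemma division k u : (k.+1 < n)%N -> u \in Omega c k.+1 -> df u = 0 ->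
  exists2 v, v \in Omega c k & u = df v.
Proof.
move=> kn uO du0; have := @division_mod k.+1 0 u; rewrite addn0 => /(_ kn uO).
case=> [I m _|v vO uv]; first by rewrite du0 ffunE.
exists v => //; apply/eqP; rewrite -subr_eq0; apply/eqP/ffunP => I.
by apply/funext => m; rewrite uv ?ffunE.
Qed.

End Division.

(** * Consequences of finite codimension *)

Section FiniteCodimension.
Variables (n : nat) (K : numFieldType) (c : category) (f : {mpoly K[n]}).
Variables (w : 'I_n -> nat) (N : nat).
Hypothesis w_gt0 : forall i, (0 < w i)%N.
Hypothesis fN : quasihomogeneous w N%:Z (poly_series f).
Hypothesis f_finite : finite_codimension c (poly_series f).

Lemma linear_relation d (V : lmodType K) (e : 'I_d -> V) (x : 'I_d.+1 -> V) :
  (forall k, exists a : 'I_d -> K, x k = \sum_i a i *: e i) ->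
  exists (t : 'I_d.+1 -> K) (k : 'I_d.+1), t k != 0 /\ \sum_k t k *: x k = 0.
Proof.
move=> /choice[a xE]; pose B : 'M[K]_(d.+1, d) := \matrix_(k, i) a k i.
have kerB : kermx B != 0.
  by rewrite kermx_eq0 /row_free neq_ltn (leq_ltn_trans (rank_leq_col B)).
have /rowV0Pn[t /sub_kermxP tB t0] := kerB.
have /rV0Pn[k tk] := t0; exists (t 0), k; split=> //.
under eq_bigr => l _ do rewrite xE scaler_sumr.
rewrite exchange_big big1 //= => i _.
under eq_bigr => l _ do rewrite scalerA.
rewrite -scaler_suml; have /rowP/(_ i) := tB; rewrite !mxE => tBi.
suff -> : \sum_l t 0 l * a l i = 0 by rewrite scale0r.
by rewrite -[RHS]tBi; apply: eq_bigr => l _; rewrite mxE.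
Qed.

(** The powers of [x_i] cannot be independent in a finite dimensional
    quotient. *)
Lemma pow_relation i :
  exists (d : nat) (t : 'I_d.+1 -> K) (k : 'I_d.+1) (a : 'I_n -> series n K),
    t k != 0 /\ \sum_k t k *: poly_series 'X_[U_(i) *+ k] =
      \sum_j a j * partial j (poly_series f).
Proof.
have [d [e eP]] := f_finite.
pose x (k : 'I_d.+1) : subspace (@germs n K c) :=
  exist _ (poly_series 'X_[U_(i) *+ k]) (poly_series_germs c _).
have [t [k [tk tx]]] := linear_relation (fun k => eP (proj (jacobian_ideal c (poly_series f)) (x k))).
have : proj (jacobian_ideal c (poly_series f)) (\sum_k t k *: x k) =
       proj (jacobian_ideal c (poly_series f)) 0.
  rewrite raddf0 -[RHS]tx linear_sum; apply: eq_bigr => l _; exact: linearZ.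
move/proj_eq; rewrite (raddf0 (val : subspace (@germs n K c) -> _)) subr0.
case/asboolP=> a _ aE.
exists d, t, k, a; split=> //; rewrite -aE.
rewrite (raddf_sum (val : subspace (@germs n K c) -> _)); exact: eq_bigr.
Qed.

Lemma quasihomogeneous_weight d (a : series n K) m :
  quasihomogeneous w d%:Z a -> a m != 0 -> mon_weight w m = d.
Proof.
move=> /(congr1 (fun a : series n K => a m)); rewrite Lie_eulerE seriesZE.
by move=> + a0 => /(mulIf a0)/eqP; rewrite eqr_nat => /eqP.
Qed.

Lemma mon_weightD m m' : mon_weight w (m + m') = (mon_weight w m + mon_weight w m')%N.
Proof.
by rewrite /mon_weight -big_split; apply: eq_bigr => i _; rewrite mnmDE mulnDr.
Qed.

Lemma mon_weightU i k : mon_weight w (U_(i) *+ k) = (w i * k)%N.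
Proof.
rewrite /mon_weight (bigD1 i) //= big1 ?addn0 => [|j ji].
  by rewrite mulmnE mnm1E eqxx mul1n.
by rewrite mulmnE mnm1E eq_sym (negbTE ji) muln0.
Qed.

Lemma mdeg_le_mon_weight m : (mdeg m <= mon_weight w m)%N.
Proof. by rewrite mdegE; apply: leq_sum => i _; rewrite leq_pmull. Qed.

Lemma truncation_series (a : series n K) d :
  (forall m, a m != 0 -> (mon_weight w m <= d)%N) ->
  poly_series (truncation d.+1 a) = a.
Proof.
move=> ad; apply/funext => m; rewrite /poly_series.
have [a0|a0] := eqVneq (a m) 0; last first.
  by rewrite truncationE // ltnS (leq_trans (mdeg_le_mon_weight m)) ?ad.
rewrite /truncation raddf_sum /= big1 // => l _; rewrite mcoeffZ mcoeffX.
by case: eqP => [->|]; rewrite ?a0 ?mul0r ?mulr0.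
Qed.

(** The relation between powers of [x_i] modulo the partial derivatives is
    homogenized: its part of weight [w i * k] only involves the [k]-th power,
    and the parts of the coefficients which contribute to it are polynomials,
    all weights being positive. *)
Lemma pow_in_jacobian_ideal i :
  exists (k : nat) (A : 'I_n -> {mpoly K[n]}), poly_series 'X_[U_(i) *+ k] =
    \sum_j poly_series (A j) * partial j (poly_series f).
Proof.
have [d [t [k [a [tk aE]]]]] := pow_relation i.
pose b j : series n K := fun m =>
  if (mon_weight w m + N == w i * k + w j)%N then (t k)^-1 * a j m else 0.
exists k, (fun j => truncation (w i * k + w j).+1 (b j)).
have bE j m : (b j * partial j (poly_series f)) m =
  if mon_weight w m == (w i * k)%N then (t k)^-1 * (a j * partial j (poly_series f)) m else 0.
  have -> : (if mon_weight w m == (w i * k)%N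
      then (t k)^-1 * (a j * partial j (poly_series f)) m else 0) =
      \sum_(l : 'X_{1..n < (mdeg m).+1, (mdeg m).+1} | m == (l.1 + l.2)%MM)
        (if mon_weight w m == (w i * k)%N
         then (t k)^-1 * (a j l.1 * partial j (poly_series f) l.2) else 0).
    by case: ifP => _; [rewrite seriesME mulr_sumr | rewrite big1].
  rewrite seriesME; apply: eq_bigr => -[p q] /= /eqP mE.
  have [->|fq] := eqVneq (partial j (poly_series f) q) 0.
    by rewrite !mulr0 if_same.
  have Nq : N = (mon_weight w q + w j)%N.
    rewrite -[w j]muln1 -mon_weightU mulm1n -mon_weightD; apply/esym.
    apply: quasihomogeneous_weight fN _; apply: contraNneq fq => f0.
    by rewrite partialE f0 mul0rn.
  by rewrite /b Nq addnA eqn_add2r -mon_weightD -mE; case: ifP => _; rewrite ?mul0r ?mulrA.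
under eq_bigr => j _.
  rewrite truncation_series; last first.
    move=> m; rewrite /b; case: ifP => [/eqP <- _|_]; first exact: leq_addr.
    by rewrite eqxx.
  over.
apply/funext => m; rewrite series_sumE; under eq_bigr => j _ do rewrite bE.
case: (eqVneq (mon_weight w m) (w i * k)%N) => [mk|mk]; last first.
  rewrite big1 // /poly_series mcoeffX; case: eqP => // mE.
  by rewrite -mE mon_weightU eqxx in mk.
rewrite -mulr_sumr.
rewrite -(series_sumE _ _ (fun j => a j * partial j (poly_series f))) -aE series_sumE (bigD1 k) //= big1 => [|l lk].
  by rewrite addr0 seriesZE mulKf.
rewrite seriesZE /poly_series mcoeffX; case: eqP => [mE|]; last by rewrite mulr0.
move/eqP: mk; rewrite -mE mon_weightU eqn_pmul2l // => /eqP/val_inj lkE.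
by rewrite lkE eqxx in lk.
Qed.

End FiniteCodimension.

Lemma meval_at0 n (K : numFieldType) (f : {mpoly K[n]}) :
  f.@[fun=> 0] = f@_0.
Proof.
have prod0 (m : 'X_{1..n}) : m != 0%MM -> \prod_i (0 : K) ^+ m i = 0.
  move=> m0; have /existsP[i mi] : [exists i, m i != 0%N].
    apply: contraNT m0 => /existsPn mi; apply/eqP/mnmP => i.
    by rewrite mnm0E; apply/eqP; have := mi i; rewrite negbK.
  by apply/eqP; rewrite prodf_seq_eq0; apply/hasP; exists i; rewrite ?mem_index_enum ?expr0n //= (negbTE mi).
rewrite mevalE; have [f0|f0] := boolP (0%MM \in msupp f).
  rewrite (bigD1_seq 0%MM) ?msupp_uniq //= [X in _ + X]big1 => [|m m0].
    by rewrite addr0 big1 ?mulr1 // => i _; rewrite mnm0E.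
  by rewrite prod0 ?mulr0.
rewrite (memN_msupp_eq0 f0) big_seq big1 // => m mf; rewrite prod0 ?mulr0 //.
by apply: contraNneq f0 => <-.
Qed.

(** Finite codimension excludes [f = 0]; as [f] vanishes at the origin, its
    degree is the weight of a nonconstant monomial. *)
Lemma quasihomogeneous_degree_gt0 n (K : numFieldType) c (f : {mpoly K[n]})
    (w : 'I_n -> nat) (N : int) :
  (0 < n)%N -> (forall i, (0 < w i)%N) ->
  quasihomogeneous w N (poly_series f) -> f.@[fun=> 0] = 0 ->
  finite_codimension c (poly_series f) -> exists2 d, (0 < d)%N & N = d%:Z.
Proof.
move=> n_gt0 w_gt0 fN f0 f_finite.
have partial_ps0 j : partial j (poly_series 0) = 0 :> series n K.
  by rewrite partial_poly_series mderiv0; apply/funext => m; apply: mcoeff0.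
have [fz|/eqP fz] := eqVneq f 0.
  (* Zero is quasihomogeneous of any degree; take degree one. *)
  rewrite {}fz in fN f_finite; have f1 : quasihomogeneous w 1%N%:Z (poly_series (0 : {mpoly K[n]})).
    rewrite /quasihomogeneous /Lie big1 => [|j _]; last by rewrite partial_ps0 mulr0.
    by apply/funext => m; rewrite seriesZE /poly_series mcoeff0 mulr0.
  have [k [A /(congr1 (fun a : series n K => a (U_(Ordinal n_gt0) *+ k)%MM))]] :=
    pow_in_jacobian_ideal w_gt0 f1 f_finite (Ordinal n_gt0).
  rewrite big1 => [|j _]; last by rewrite partial_ps0 mulr0.
  by rewrite /poly_series mcoeffX eqxx => /eqP; rewrite oner_eq0.
have [m fm] : exists m, f@_m != 0.
  apply: contra_notP fz => fm; apply/mpolyP => m; rewrite mcoeff0.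
  by apply/eqP; apply: contra_notT fm => ?; exists m.
have m0 : m != 0%MM by apply: contraNneq fm => ->; rewrite -meval_at0 f0.
exists (mon_weight w m).
  by apply: leq_trans (mdeg_le_mon_weight w_gt0 m); rewrite lt0n mdeg_eq0.
move/(congr1 (fun a : series n K => a m)): fN; rewrite Lie_eulerE seriesZE.
by move/(mulIf fm)/eqP; rewrite -[(_)%:R]/((Posz _)%:~R) eqr_int => /eqP.
Qed.

(** * The cohomology space *)

Section Cohomology.
Variables (d : nat) (K : numFieldType) (c : category).
Variables (f : {mpoly K[d.+3]}) (w : 'I_d.+3 -> nat) (N : nat).
Implicit Types (u v : form d.+3 K) (h : {mpoly K[d.+3]}).

Hypothesis w_gt0 : forall i, (0 < w i)%N.
Hypothesis N_gt0 : (0 < N)%N.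
Hypothesis fN : quasihomogeneous w N%:Z (poly_series f).
Hypothesis f_finite : finite_codimension c (poly_series f).

Local Notation D := (@diff d.+3 K).
Local Notation F := (poly_series f).
Local Notation df := (df_wedge F).
Local Notation iW := (interior (euler_field K w)).
Local Notation lieW := (lie w).
Local Notation vol := (volume d.+3 K).
Local Notation sigmaN := (quasihomogeneous_sigma w (N%:Z - (\sum_i w i)%:Z)).

Let N_neq0 : N%:R != 0 :> K.
Proof. by rewrite pnatr_eq0 -lt0n. Qed.

Lemma df_division k u : (k < d.+2)%N -> u \in Omega c k.+1 -> df u = 0 ->
  exists2 v, v \in Omega c k & u = df v.
Proof.
have /choice[M /choice[A powE]] := pow_in_jacobian_ideal w_gt0 fN f_finite.
by move=> kd; apply: (division powE).
Qed.

Lemma interior_Omega_euler k u : u \in Omega c k.+1 -> iW u \in Omega c k.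
Proof. by rewrite euler_fieldE; apply: interior_Omega. Qed.

Lemma lie_surj k u : (0 < k)%N -> u \in Omega c k ->
  exists2 v, v \in Omega c k & u = lieW v.
Proof.
move=> k0 uO; exists (lie_shift_inv w 0 u); first exact: lie_shift_inv_Omega.
rewrite -{1}(@lie_shift_invK _ _ w 0 u) ?scale0r ?addr0 // => I.
by rewrite addn0; apply: set_weight_gt0 uO.
Qed.

Lemma lieN_surj k u : u \in Omega c k ->
  exists2 v, v \in Omega c k & u = lieW v + N%:R *: v.
Proof.
move=> uO; exists (lie_shift_inv w N u); first exact: lie_shift_inv_Omega.
by rewrite lie_shift_invK // => I; left; rewrite addn_gt0 N_gt0 orbT.
Qed.

Lemma lie_inj k u : (0 < k)%N -> u \in Omega c k -> lieW u = 0 -> u = 0.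
Proof.
move=> k0 uO u0; apply/ffunP => I; apply/funext => m.
have [wI|->] := set_weight_gt0 I w_gt0 k0 uO; last by rewrite ffunE.
move/ffunP/(_ I)/(congr1 (fun a : series _ K => a m)): u0.
rewrite !ffunE => /eqP; rewrite mulf_eq0 pnatr_eq0 addn_eq0 => /orP[|/eqP //].
by rewrite (gtn_eqF wI) andbF.
Qed.

Lemma top_form u : u \in Omega c d.+3 -> u = fmul (u setT) vol.
Proof.
move=> /OmegaP uO; apply/ffunP => I; rewrite !ffunE; case: eqP => [->|IT].
  by rewrite mulr1.
rewrite mulr0; have [_ ->] // := uO I; apply: contra_not_neq IT => I3.
by apply/eqP; rewrite eqEcard subsetT cardsT card_ord I3 leqnn.
Qed.

Lemma volume_Omega h : fmul (poly_series h) vol \in Omega c d.+3.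
Proof.
apply: fmul_Omega; apply/OmegaP => I; rewrite ffunE; case: eqP => [->|_].
  by rewrite (poly_series_germs c 1) cardsT card_ord eqxx.
by rewrite rpred0.
Qed.

Lemma interior_volume a : iW (fmul a vol) = fmul a (sigma K w).
Proof. exact: interior_fmul. Qed.

Lemma lie_volumeE a m : lieW (fmul a vol) setT m =
  (mon_weight w m + \sum_i w i)%:R * a m.
Proof.
by rewrite !ffunE eqxx mulr1 /set_weight; congr ((_ + _)%:R * _); apply: eq_bigl => i; rewrite inE.
Qed.

Lemma lie_volume h : quasihomogeneous w (N%:Z - (\sum_i w i)%:Z) (poly_series h) ->
  lieW (fmul (poly_series h) vol) = N%:R *: fmul (poly_series h) vol.
Proof.
move=> hq; apply/ffunP => I; apply/funext => m.
have [->|IT] := eqVneq I setT; last first.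
  by rewrite !ffunE (negbTE IT) mulr0 !seriesZE series0E !mulr0.
rewrite lie_volumeE !ffunE eqxx mulr1 seriesZE.
move/(congr1 (fun a : series _ K => a m)): hq; rewrite Lie_eulerE seriesZE => hm.
by rewrite natrD mulrDl hm -mulrDl rmorphB /= subrK.
Qed.

Lemma lie_eigen_top u : u \in Omega c d.+3 -> lieW u = N%:R *: u ->
  exists2 h, quasihomogeneous w (N%:Z - (\sum_i w i)%:Z) (poly_series h)
    & u = fmul (poly_series h) vol.
Proof.
move=> uO uN; set a := u setT; have uE : u = fmul a vol := top_form uO.
have am m : a m != 0 -> (mon_weight w m + \sum_i w i)%N = N.
  move=> a0; have := congr1 (fun v : form d.+3 K => v setT m) uN.
  rewrite {1}uE lie_volumeE ffunE seriesZE -/a => /(mulIf a0)/eqP.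
  by rewrite eqr_nat => /eqP.
have aE : poly_series (truncation N.+1 a) = a.
  by apply: (truncation_series w_gt0) => m /am <-; rewrite leq_addr.
exists (truncation N.+1 a); rewrite aE //.
apply/funext => m; rewrite Lie_eulerE seriesZE.
have [->|/am <-] := eqVneq (a m) 0; first by rewrite !mulr0.
by rewrite PoszD addrK.
Qed.

(** Division writes [u] as [iW (diff u) / N + df b]; inverting the Lie derivative
    on [b] leaves the contraction of a top degree form of weight [N], which
    lies in [sigmaN]. *)
Lemma cocycle_decomposition u : u \in Omega c d.+2 -> fmul F (diff u) = df u ->
  exists2 e, e \in sigmaN & exists2 g, g \in Omega c d &
    exists2 x, x \in Omega c d.+1 & u = e + df (diff g) + fmul F (diff x).
Proof.
move=> uO cu; set t := diff u.
have tO : t \in Omega c d.+3 by apply: diff_Omega.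
have lie_t : lieW t = diff (iW t) by rewrite -cartan diff_diff linear0 addr0.
have df_iWt : df (iW t) = N%:R *: df u.
  have := interior_euler_df_wedge fN t.
  rewrite (Omega_gt _ (df_wedge_Omega f tO)) // linear0 cu.
  by move/esym/eqP; rewrite subr_eq0 => /eqP.
have [b bO uE] : exists2 b, b \in Omega c d.+1 & u - N%:R^-1 *: iW t = df b.
  apply: df_division => //; first by rewrite rpredB ?rpredZ ?interior_Omega_euler.
  by rewrite linearB linearZ /= df_iWt scalerA mulVf // scale1r subrr.
have [x xO bE] := lie_surj (ltn0Sn d) bO.
(* Modulo the two other summands, [u] is [iW v], with [v] of weight [N]. *)
pose v := N%:R^-1 *: t - df (diff x).
have vO : v \in Omega c d.+3.
  by rewrite rpredB ?rpredZ ?df_wedge_Omega ?diff_Omega.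
have dE : t - N%:R^-1 *: lieW t = - df (diff b).
  by rewrite -diff_df_wedge -uE (linearB D) (linearZ_LR D) lie_t.
have vN : lieW v = N%:R *: v.
  rewrite linearB linearZ /= (lie_df_wedge fN) lie_diff -bE scalerBr scalerA.
  rewrite divff // scale1r opprD addrA; congr (_ - _).
  by rewrite -dE addrCA subrr addr0.
have [h hq vE] := lie_eigen_top vO vN.
exists (fmul (poly_series h) (sigma K w)); first by apply/asboolP; exists h.
exists (iW x); first exact: interior_Omega_euler.
exists (N%:R *: x); first exact: rpredZ.
rewrite -interior_volume -vE linearB linearZ /= (interior_euler_df_wedge fN).
have -> : iW (diff x) = b - diff (iW x) by rewrite bE -cartan addrAC subrr add0r.
rewrite [u in LHS](_ : u = N%:R^-1 *: iW t + df b); last by rewrite -uE addrC subrK.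
rewrite (linearB df) (linearZ_LR D) (linearZ_LR (fmul F)) /=.
by rewrite opprB -[RHS]addrA -[RHS]addrA -(addrA (df b)) -opprD subrK.
Qed.

Lemma sigma_cocycle e : e \in sigmaN ->
  e \in Omega c d.+2 /\ fmul F (diff e) = df e.
Proof.
case/asboolP=> h hq ->; rewrite -interior_volume; set u := fmul _ _.
have uO : u \in Omega c d.+3 := volume_Omega h.
have du0 : diff u = 0 by apply: Omega_gt (diff_Omega uO).
split; first exact: interior_Omega_euler.
have -> : diff (iW u) = N%:R *: u.
  by rewrite -lie_volume // -cartan du0 linear0 addr0.
have /eqP := interior_euler_df_wedge fN u.
rewrite (Omega_gt _ (df_wedge_Omega f uO)) // linear0 eq_sym subr_eq0 => /eqP <-.
by rewrite linearZ.
Qed.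

Lemma df_d_cocycle g : g \in Omega c d ->
  df (diff g) \in Omega c d.+2 /\ fmul F (diff (df (diff g))) = df (df (diff g)).
Proof.
move=> gO; split; first by rewrite df_wedge_Omega ?diff_Omega.
by rewrite diff_df_wedge diff_diff df_df_wedge linear0 oppr0 linear0.
Qed.

(** Applying [diff] shows that the form of weight [N] underlying [e] is also in
    the image of [lie - N], hence zero.  The remaining equation is solved by
    two divisions and one inversion of [lie + N]. *)
Lemma coboundary_decomposition e g x :
    e \in sigmaN -> g \in Omega c d -> x \in Omega c d.+1 ->
    e + df (diff g) = fmul F (diff x) ->
  e = 0 /\ exists2 b, b \in Omega c d & df (diff g) = df (diff (fmul F b)).
Proof.
case/asboolP=> h hq -> gO xO; rewrite -interior_volume; set u := fmul _ _ => E.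
have uO : u \in Omega c d.+3 := volume_Omega h.
have diu : diff (iW u) = N%:R *: u.
  by rewrite -lie_volume // -cartan (Omega_gt _ (diff_Omega uO)) // linear0 addr0.
have Nu : N%:R *: u = df (diff x).
  have := congr1 (@diff _ K) E; rewrite linearD /= diu diff_df_wedge diff_diff.
  by rewrite linear0 oppr0 addr0 diff_fmul diff_diff linear0 addr0.
have [y yO xE] := lie_surj (ltn0Sn d) xO.
have Ny : N%:R *: u = lieW (df (diff y)) - N%:R *: df (diff y).
  by rewrite Nu xE -lie_diff (lie_df_wedge fN) addrK.
have u0 : u = 0.
  have /eqP : N%:R *: u = 0.
    rewrite Ny; apply/eqP; rewrite subr_eq0; apply/eqP.
    by apply: lie_sub_eq0; rewrite -Ny linearZ /= lie_volume.
  by rewrite scaler_eq0 (negbTE N_neq0) => /eqP.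
split; first by rewrite u0 linear0.
move: E; rewrite u0 linear0 add0r => E.
have dfdx : df (diff x) = 0 by rewrite -Nu u0 scaler0.
have [mu muO dxE] := df_division (ltnSn _) (diff_Omega xO) dfdx.
have [nu nuO nuE] : exists2 nu, nu \in Omega c d & diff g - fmul F mu = df nu.
  apply: df_division => //; first by rewrite rpredB ?fmul_Omega ?diff_Omega.
  by rewrite linearB /= df_wedge_fmul -dxE E subrr.
have kO : N%:R *: nu + iW mu \in Omega c d.
  by rewrite rpredD ?rpredZ ?interior_Omega_euler.
have [b bO bE] := lieN_surj kO.
exists b => //; rewrite E diff_fmul linearD /= df_df_wedge add0r df_wedge_fmul.
congr fmul; apply/eqP; rewrite -subr_eq0; apply/eqP.
apply: (@lie_inj d.+2) => //; first by rewrite rpredB ?df_wedge_Omega ?diff_Omega.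
have dfmu : diff (fmul F mu) = df (diff nu).
  by rewrite -[fmul F mu](subrK (diff g)) -opprB nuE addrC linearB /= diff_diff diff_df_wedge opprK add0r.
rewrite linearB /= (_ : lieW (D x) = df (D (N%:R *: nu + iW mu))); last first.
  rewrite -cartan diff_diff linear0 addr0 dxE (interior_euler_df_wedge fN).
  rewrite (linearB D) (linearZ_LR D) /= dfmu diff_df_wedge opprK.
  by rewrite (linearD D) (linearZ_LR D) (linearD df) (linearZ_LR df).
rewrite bE (lie_df_wedge fN) lie_diff (linearD D) (linearZ_LR D) /=.
by rewrite (linearD df) (linearZ_LR df) subrr.
Qed.

(** The classes killed in the quotient of the forms [df (diff g)] are exact. *)
Lemma df_df_coboundary b :
  df (diff (fmul F b)) = fmul F (diff (- df b)).
Proof.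
rewrite diff_fmul linearD /= df_df_wedge add0r df_wedge_fmul.
by rewrite linearN /= diff_df_wedge opprK.
Qed.

Lemma cohomology_decomposition :
  let H := cohomology c F (d.+3%:Z - 2) d.+2 in
  let E := subspace sigmaN in
  let Q := subquot (df_d c F d) (df_df c F d) in
  exists (iE : {linear E -> H}) (iF : {linear Q -> H}),
    [/\ natural_map iE, natural_quotient_map iF
      & bijective (fun x : E * Q => iE x.1 + iF x.2)].
Proof.
have d1 : d.+3%:Z - 2 = d.+1%:Z by rewrite -addn2 PoszD addrK.
have tw1 u : twisted_diff F (d.+3%:Z - 2) d.+2 u = fmul F (D u) - df u.
  rewrite /twisted_diff (_ : d.+2%:Z - (d.+3%:Z - 2) = 1) ?scale1r //.
  by rewrite d1 -addn1 PoszD addrAC subrr.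
have tw0 u : twisted_diff F (d.+3%:Z - 2) d.+1 u = fmul F (D u).
  rewrite /twisted_diff (_ : d.+1%:Z - (d.+3%:Z - 2) = 0) ?scale0r ?subr0 //.
  by rewrite d1 subrr.
have cocycleP u : reflect (u \in Omega c d.+2 /\ fmul F (D u) = df u)
    (u \in cocycles c F (d.+3%:Z - 2) d.+2).
  apply: (iffP andP) => -[uO]; first by rewrite tw1 subr_eq0 => /eqP.
  by move=> uE; rewrite tw1 uE subrr.
have coboundaryP u : u \in coboundaries c F (d.+3%:Z - 2) d.+2 <->
    exists2 v, v \in Omega c d.+1 & u = fmul F (D v).
  by split=> [/asboolP[v vO ->]|[v vO ->]]; last apply/asboolP; exists v; rewrite ?tw0.
move=> H E Q.
have [iE iEn] : exists g : {linear E -> H}, natural_map g.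
  apply: natural_map_exists => u uE; exact/cocycleP/sigma_cocycle.
have [iF iFn] : exists g : {linear Q -> H}, natural_quotient_map g.
  apply: natural_quotient_map_exists => u /asboolP[g gO ->].
    exact/cocycleP/df_d_cocycle.
  apply/coboundaryP; exists (- df g); first by rewrite rpredN df_wedge_Omega.
  exact: df_df_coboundary.
exists iE, iF; split=> //.
have inj0 x y : iE x + iF y = 0 -> x = 0 /\ y = 0.
  have [z ->] := proj_surj y; have [x2 x2E ->] := iEn x.
  have [z2 z2E ->] := iFn z; rewrite -raddfD -[0](raddf0 (proj _)) => /proj_eq.
  have : val z \in df_d c F d := valP z; case/asboolP=> g gO zE.
  rewrite (raddf0 val) subr0 (raddfD val) /= x2E z2E zE => /coboundaryP[v vO vE].
  have [x0 [b bO gE]] := coboundary_decomposition (valP x) gO vO vE.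
  split; first by apply: val_inj; rewrite x0.
  rewrite -(raddf0 (proj _)); apply/proj_eq; rewrite (raddf0 val) subr0 zE gE.
  by apply/asboolP; exists b.
have surj y : exists x : E * Q, y = iE x.1 + iF x.2.
  have [z ->] := proj_surj y; have /cocycleP[zO cz] := valP z.
  have [e eE [g gO [v vO zE]]] := cocycle_decomposition zO cz.
  have gF : df (D g) \in df_d c F d by apply/asboolP; exists g.
  pose x1 : E := exist _ e eE.
  pose x2 : subspace (df_d c F d) := exist _ (df (D g)) gF.
  exists (x1, proj _ x2) => /=; have [y1 y1E ->] := iEn x1.
  have [y2 y2E ->] := iFn x2; rewrite -raddfD; apply/proj_eq/coboundaryP.
  by exists v => //; rewrite (raddfD val) /= y1E y2E zE /= [LHS]addrC addKr.
exact: direct_sum_bijective.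
Qed.

End Cohomology.

Theorem theorem3p30 (R : realType) (k : ground_field) (c : category) (n : nat)
    (w : 'I_n -> nat) (N : int) (f : {mpoly (scalars R k)[n]})
    (n_ge3 : (3 <= n)%N) (w_gt0 : forall i, (0 < w i)%N)
    (f_quasihomogeneous : quasihomogeneous w N (poly_series f))
    (f_at0 : f.@[fun=> 0] = 0)
    (f_finite : finite_codimension c (poly_series f)) :
  let H := cohomology c (poly_series f) (n%:Z - 2) (n - 1) in
  let E := subspace (quasihomogeneous_sigma w (N - (\sum_i w i)%:Z)) in
  let F := subquot (df_d c (poly_series f) (n - 3))
                   (df_df c (poly_series f) (n - 3)) in
  exists (iE : {linear E -> H}) (iF : {linear F -> H}),
    [/\ natural_map iE, natural_quotient_map iF
      & bijective (fun x : E * F => iE x.1 + iF x.2)].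
Proof.
have n_gt0 : (0 < n)%N by apply: leq_trans n_ge3.
have [d d_gt0 NE] :=
  quasihomogeneous_degree_gt0 n_gt0 w_gt0 f_quasihomogeneous f_at0 f_finite.
move: f_quasihomogeneous; rewrite {}NE {n_gt0 f_at0} => f_quasihomogeneous.
case: n w f n_ge3 w_gt0 f_finite f_quasihomogeneous => [|[|[|n]]] w f // _.
rewrite subn1 (_ : (n.+3 - 3)%N = n) /=; last by rewrite !subSS subn0.
by move=> w_gt0 f_finite fN; apply: cohomology_decomposition.
Qed.
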